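(* Let $(X,d_X)$ be a compact connected path metric space and let $r\in X$ be a base point such that the metric Reeb graph $(G,d_G)$ of $d=d_X(r,\cdot):X\to\mathbb R$ is a finite graph. If for some $\varepsilon>0$ there exists a finite metric graph $(G',d_{G'})$ with $d_{GH}(X,G')<\varepsilon$, then \[ d_{GH}(X,G)<(\beta_1(G)+1)\,(17+8N_{E,G'}(8\varepsilon))\,\varepsilon, \] where $N_{E,G'}(8\varepsilon)$ is the number of edges of $G'$ of length at most $8\varepsilon$ and $\beta_1(G)$ is the first Betti number of $G$. In particular, if $X$ is at Gromov–Hausdorff distance less than $\varepsilon$ from a finite metric graph whose shortest edge has length larger than $8\varepsilon$, then $d_{GH}(X,G)<17(\beta_1(G)+1)\varepsilon$.
   Context: A path metric space is one in which the distance between any two points is the infimum of lengths of continuous curves joining them. Reeb graph: for $x,y\in X$ set $x\sim y$ iff $d(x)=d(y)$ and $x,y$ lie in the same path-connected component of $d^{-1}(d(x))$; $G=X/\sim$ with quotient map $\pi$, and $d$ induces $d_*:G\to\mathbb R_+$ with $d=d_*\circ\pi$. Metric structure (when $G$ is a finite topological graph): the vertex set consists of the points of degree $\neq2$, the local maxima of $d_*$, and $\pi(r)$; the edges are the connected components of the complement of the vertex set; each edge is given length equal to the absolute difference of $d_*$ at its endpoints, the distance between two points $p,p'$ of the same edge being $|d_*(p)-d_*(p')|$; $d_G$ is the resulting metric-graph metric. A finite metric graph is a finite 1-dimensional simplicial complex with each edge identified with a real segment, with the induced path metric. $d_{GH}$ is the Gromov–Hausdorff distance: half the infimum of $\eta\ge0$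 such that there is a correspondence $C$ between the two spaces (projecting surjectively onto both factors) with $|d(x,x')-d(y,y')|\le\eta$ for all $(x,y),(x',y')\in C$. *)

(* Defs.v *)
From Stdlib Require Import Reals List Sorted.
From Coquelicot Require Import Coquelicot.
From mathcomp Require Import ssreflect ssrfun ssrbool eqtype ssrnat seq fintype fingraph.

Set Implicit Arguments.
Unset Strict Implicit.
Unset Printing Implicit Defensive.

Local Open Scope R_scope.

Definition is_metric (T : Type) (d : T -> T -> R) : Prop :=
  (forall x y, d x y = 0 <-> x = y) /\
  (forall x y, d x y = d y x) /\
  (forall x y z, d x z <= d x y + d y z).

Definition open_in (T : Type) (d : T -> T -> R) (U : T -> Prop) : Prop :=
  forall x, U x -> exists e, 0 < e /\ forall y, d x y < e -> U y.

Definition compact_space (T : Type) (d : T -> T -> R) : Prop :=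
  forall (I : Type) (U : I -> T -> Prop),
    (forall i, open_in d (U i)) -> (forall x, exists i, U i x) ->
    exists l : list I, forall x, exists i, List.In i l /\ U i x.

Definition connected_space (T : Type) (d : T -> T -> R) : Prop :=
  forall U V : T -> Prop, open_in d U -> open_in d V ->
    (forall x, U x \/ V x) -> (forall x, ~ (U x /\ V x)) ->
    (forall x, ~ U x) \/ (forall x, ~ V x).

Definition unit_interval (t : R) : Prop := 0 <= t <= 1.

Definition cont_on_I (T : Type) (d : T -> T -> R) (g : R -> T) : Prop :=
  forall t, unit_interval t -> forall e, 0 < e ->
    exists del, 0 < del /\ forall s, unit_interval s -> Rabs (s - t) < del ->
      d (g s) (g t) < e.

Definition curve (T : Type) (d : T -> T -> R) (g : R -> T) (x y : T) : Prop :=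
  cont_on_I d g /\ g 0 = x /\ g 1 = y.

Fixpoint chain_len (T : Type) (d : T -> T -> R) (g : R -> T) (l : list R) : R :=
  match l with
  | t :: ((s :: _) as l') => d (g t) (g s) + chain_len d g l'
  | _ => 0
  end.

Definition length_le (T : Type) (d : T -> T -> R) (g : R -> T) (L : R) : Prop :=
  forall l : list R, Sorted Rle l -> List.Forall unit_interval l -> chain_len d g l <= L.

Definition path_metric (T : Type) (d : T -> T -> R) : Prop :=
  forall x y,
    (forall g L, curve d g x y -> length_le d g L -> d x y <= L) /\
    (forall eta, 0 < eta ->
       exists g L, curve d g x y /\ length_le d g L /\ L < d x y + eta).

(* Gromov-Hausdorff distance (with value +oo when no correspondence   *)
(* has finite distortion).                                            *)

Definition correspondence (T1 T2 : Type) (C : T1 -> T2 -> Prop) : Prop :=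
  (forall x, exists y, C x y) /\ (forall y, exists x, C x y).

Definition dGH (T1 T2 : Type) (d1 : T1 -> T1 -> R) (d2 : T2 -> T2 -> R) : Rbar :=
  Rbar_mult (/ 2)
    (Glb_Rbar (fun eta => 0 <= eta /\
       exists C : T1 -> T2 -> Prop, correspondence C /\
         forall x y x' y', C x y -> C x' y' -> Rabs (d1 x x' - d2 y y') <= eta)).

Record fgraph := FGraph {
  gV : finType;
  gE : finType;
  gsrc : gE -> gV;
  gtgt : gE -> gV;
  glen : gE -> R
}.

(* points of the metric graph: vertices, or interior points of edges,
   parametrized by the distance t to the source endpoint *)
Inductive mg_point (M : fgraph) : Type :=
  | MPv : gV M -> mg_point M
  | MPe : forall (e : gE M) (t : R), 0 < t < glen e -> mg_point M.

Fixpoint walk (M : fgraph) (u v : gV M) (w : list (gE M * bool)) : Prop :=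
  match w with
  | nil => u = v
  | (e, b) :: w' =>
      (if b then gsrc e = u else gtgt e = u) /\
      walk (if b then gtgt e else gsrc e) v w'
  end.

Fixpoint walk_len (M : fgraph) (w : list (gE M * bool)) : R :=
  match w with
  | nil => 0
  | (e, _) :: w' => glen e + walk_len w'
  end.

Definition vdist (M : fgraph) (u v : gV M) : R :=
  real (Glb_Rbar (fun L => exists w, walk u v w /\ L = walk_len w)).

Definition access (M : fgraph) (p : mg_point M) : list (gV M * R) :=
  match p with
  | MPv v => (v, 0) :: nil
  | MPe e t _ => (gsrc e, t) :: (gtgt e, glen e - t) :: nil
  end.

Definition direct (M : fgraph) (p q : mg_point M) : list R :=
  match p, q with
  | MPv u, MPv v => if u == v then 0 :: nil else nil
  | MPe e t _, MPe e' s _ => if e == e' then Rabs (t - s) :: nil else nil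
  | _, _ => nil
  end.

Definition Rmin_list (x : R) (l : list R) : R := fold_right Rmin x l.

Definition mg_dist (M : fgraph) (p q : mg_point M) : R :=
  match direct p q ++
        flat_map (fun a => map (fun b => snd a + vdist (fst a) (fst b) + snd b)
                               (access q)) (access p) with
  | nil => 0
  | x :: l => Rmin_list x l
  end.

Definition mg_connected (M : fgraph) : Prop :=
  forall u v : gV M, exists w, walk u v w.

Definition mg_positive (M : fgraph) : Prop := forall e : gE M, 0 < glen e.

Definition simplicial (M : fgraph) : Prop :=
  (forall e : gE M, gsrc e <> gtgt e) /\
  (forall e e' : gE M, (gsrc e = gsrc e' /\ gtgt e = gtgt e') \/
                (gsrc e = gtgt e' /\ gtgt e = gsrc e') -> e = e').

(* a finite metric graph: finite 1-dim simplicial complex with positive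
   edge lengths; connected (otherwise the path metric takes value +oo) *)
Definition finite_metric_graph (M : fgraph) : Prop :=
  mg_positive M /\ simplicial M /\ mg_connected M.

Definition adj (M : fgraph) : rel (gV M) :=
  fun u v => [exists e, ((gsrc e == u) && (gtgt e == v)) ||
                        ((gsrc e == v) && (gtgt e == u))].

Definition ncomp (M : fgraph) : nat := n_comp (adj (M:=M)) (gV M).

Definition betti1 (M : fgraph) : Z :=
  (Z.of_nat #|gE M| - Z.of_nat #|gV M| + Z.of_nat (ncomp M))%Z.

Definition n_short_edges (M : fgraph) (a : R) : nat :=
  #|[pred e : gE M | Rle_dec (glen e) a]|.

(* degree of a vertex (loops counted twice) *)
Definition degree (M : fgraph) (v : gV M) : nat :=
  #|[pred e : gE M | gsrc e == v]| + #|[pred e : gE M | gtgt e == v]|.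

Definition on_edge (M : fgraph) (e : gE M) (t : R) (p : mg_point M) : Prop :=
  (t = 0 /\ p = MPv (gsrc e)) \/
  (t = glen e /\ p = MPv (gtgt e)) \/
  (exists H : 0 < t < glen e, p = MPe H).

Definition reeb_rel (X : Type) (dX : X -> X -> R) (r : X) (x y : X) : Prop :=
  dX r x = dX r y /\
  exists g : R -> X, curve dX g x y /\
    forall t, unit_interval t -> dX r (g t) = dX r x.

Definition reeb_quotient (X G : Type) (dX : X -> X -> R) (r : X) (pi : X -> G) : Prop :=
  (forall g : G, exists x, pi x = g) /\
  (forall x y, pi x = pi y <-> reeb_rel dX r x y).

Definition qopen (X G : Type) (dX : X -> X -> R) (pi : X -> G) (U : G -> Prop) : Prop :=
  open_in dX (fun x => U (pi x)).

Definition local_max (X G : Type) (dX : X -> X -> R) (pi : X -> G)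
    (dstar : G -> R) (p : G) : Prop :=
  exists U : G -> Prop, qopen dX pi U /\ U p /\ forall q, U q -> dstar q <= dstar p.

(* (M, phi) is the metric structure of the Reeb graph G:
   phi : G -> |M| is a homeomorphism (quotient topology / metric topology),
   the vertices of M are exactly the points of degree <> 2, the local
   maxima of d_* and pi(r), and along each edge the parameter distance
   is |d_*(p) - d_*(p')| (so the edge length is the difference of d_* at
   its endpoints). d_G is then the metric of M transported by phi. *)
Definition reeb_metric_structure (X G : Type) (dX : X -> X -> R) (r : X)
    (pi : X -> G) (dstar : G -> R) (M : fgraph) (phi : G -> mg_point M) : Prop :=
  mg_positive M /\ mg_connected M /\
  (forall g g', phi g = phi g' -> g = g') /\
  (forall p, exists g, phi g = p) /\
  (forall U : G -> Prop,
     qopen dX pi U <-> open_in (@mg_dist M) (fun p => exists g, U g /\ phi g = p)) /\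
  (forall v g, phi g = MPv v -> degree v <> 2%N \/ local_max dX pi dstar g \/ g = pi r) /\
  (forall g, local_max dX pi dstar g \/ g = pi r -> exists v, phi g = MPv v) /\
  (forall e t t' g g', on_edge e t (phi g) -> on_edge e t' (phi g') ->
     Rabs (t - t') = Rabs (dstar g - dstar g')).

Definition reeb_dist (G : Type) (M : fgraph) (phi : G -> mg_point M) (g g' : G) : R :=
  mg_dist (phi g) (phi g').

(* Main.v *)
(* The correspondence is the graph of pi, and pi is 1-Lipschitz for d_G, so only an upper bound of
   d_X by d_G is needed. A shortest path of G lifts to X with at most 2 F + 1 jumps inside fibres,
   F being the number of forks, that is, of vertices with two edges going down; every vertex but
   the root has an edge going down, whence F <= beta_1(G).

   A jump is estimated through the image in G' of a curve in a level set of d. If this image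
   crosses an edge of G', it nearly covers it, and a geodesic going down to r from the level set
   has to leave the covered part within depth about 3 eps; comparing consecutive points that leave
   through different ends, the two ends of the edge are at distance at most 10 eps. So a fibre is
   joined by links of length at most 10 eps which, by the absence of short cycles in G' away from
   the short edges, touch the set of the at most 2 N endpoints of short edges; for N = 0 there are
   no links and d_X <= 16 eps on fibres.

   For N > 0 and F > 0, classes of vertices joined by links are counted once for the whole path,
   shortcutting the jumps which return to a class already used. For F = 0, two points of a fibre
   can be moved down together to depths 0, 4 eps and 8 eps; the level sets reached there meet
   disjoint sets of endpoints of short edges, so that one of them meets at most 2 N / 3. *)

Require Import Defs.
From Stdlib Require Import Reals List Sorted ZArith Lra Lia Classical ClassicalEpsilon.
From mathcomp Require Import ssreflect ssrfun ssrbool eqtype ssrnat seq choice path fintype finset bigop fingraph.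
From mathcomp Require Import zify.
From Coquelicot Require Import Coquelicot.

Set Implicit Arguments.
Unset Strict Implicit.
Unset Printing Implicit Defensive.

Local Open Scope R_scope.

(** * Metric graphs *)

(** The strict bound on the Gromov-Hausdorff distance gives a map [im] to G' of distortion at most 2
    E with E < eps; the gap pays, through [del], for infima that are not attained and for replacing
    curves by chains of step del / 2. This replacement is forced: [im] is not continuous, so the
    image of a curve jumps by up to 2 E + del / 2, possibly across several vertices or around an
    edge, and passing a point P from p to q can only mean d(p, P) + d(P, q) <= 2 E + del.

    Up to multiples of [del] the constants are sums of such errors. Two descents of depth 3 E, the
    distortion 2 E and two half gaps E make the 10 eps of a link; the points just after the two
    exits are only 6 E + 2 E apart in G', whence the threshold 8 eps for short edges.

    In units of eps, counting classes of links once per path gives 22 (2 F + 1) + 4 + 28 N against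
    the allowed 2 (F + 1) (17 + 8 N). This is enough when F, N >= 1 and fails when F = 0, N >= 1;
    there only one jump occurs, and endpoints of short edges are counted level by level. *)

Lemma Rmin_list_le x l y : List.In y (x :: l) -> Rmin_list x l <= y.
Proof.
rewrite /Rmin_list; elim: l => [|z l IH] /=; first by case=> // ->; lra.
have m1 := Rmin_l z (fold_right Rmin x l); have m2 := Rmin_r z (fold_right Rmin x l).
case=> [e|[e|i]]; first by have := IH (or_introl e); lra.
  by lra.
by have := IH (or_intror i); lra.
Qed.

Lemma Rmin_list_in x l : List.In (Rmin_list x l) (x :: l).
Proof.
rewrite /Rmin_list; elim: l => [|z l IH] /=; first by left.
rewrite /Rmin; case: Rle_dec => _; first by right; left.
by case: IH; [left | right; right].
Qed.

Section MetricGraph.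
Variable M : fgraph.
Hypothesis posM : mg_positive M.
Hypothesis connM : mg_connected M.

Implicit Types (u v : gV M) (p q : mg_point M) (w : list (gE M * bool)).

(** An explicit connection in place of an infimum: a strict bound on [mg_dist] yields [conn], and
    [conn] yields a weak bound. Connections can be reversed, concatenated and inspected edge by
    edge, which is how all distance estimates in metric graphs are made below. *)
Definition conn p q (L : R) : Prop :=
  (exists x, List.In x (direct p q) /\ x <= L) \/
  exists a b w, [/\ List.In a (access p), List.In b (access q), walk a.1 b.1 w
    & snd a + walk_len w + snd b <= L].

Lemma walk_len_ge0 w : 0 <= walk_len w.
Proof. by elim: w => [|[e b] w IH] /=; [lra | have := posM e; lra]. Qed.

Lemma walk_cat u v z w1 w2 : walk u v w1 -> walk v z w2 -> walk u z (w1 ++ w2).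
Proof. by elim: w1 u => [|[e b] w1 IH] u /=; [move-> | case=> ? /IH h /h]. Qed.

Lemma walk_len_cat w1 w2 : walk_len (w1 ++ w2) = walk_len w1 + walk_len w2.
Proof. by elim: w1 => [|[e b] w1 IH] /=; [lra | rewrite IH; lra]. Qed.

Lemma walk_sym u v w : walk u v w -> exists2 w', walk v u w' & walk_len w' = walk_len w.
Proof.
elim: w u => [|[e b] w IH] u /=; first by move->; exists nil.
case=> h /IH [w' W' l]; exists (w' ++ (e, ~~ b) :: nil).
  by apply: (walk_cat W'); move: h; case: (b) => /= ->.
by rewrite walk_len_cat /= l; lra.
Qed.

(** [real] sends an infinite infimum to 0; connectedness excludes the value +oo and positive lengths
    exclude -oo. *)
Lemma vdist_spec u v :
  is_glb_Rbar (fun L => exists w, walk u v w /\ L = walk_len w) (Finite (vdist u v)).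
Proof.
rewrite /vdist; set S := (fun L => _).
have := Glb_Rbar_correct S; case: (Glb_Rbar S) => [x||] //=.
- by case=> lb _; case: (connM u v) => w W; case: (lb (walk_len w)); exists w.
- by case=> _ gr; exfalso; apply: (gr (Rbar.Finite 0)) => x [w [_ ->]]; apply: walk_len_ge0.
Qed.

Lemma vdist_le u v w : walk u v w -> vdist u v <= walk_len w.
Proof. by move=> W; case: (vdist_spec u v) => lb _; apply: (lb (walk_len w)); exists w. Qed.

Lemma vdist_lt u v L : vdist u v < L -> exists2 w, walk u v w & walk_len w < L.
Proof.
move=> h; apply: NNPP => no; case: (vdist_spec u v) => _ /(_ (Finite L)) gr.
suff HH : is_lb_Rbar (fun L => exists w, walk u v w /\ L = walk_len w) L by move: (gr HH) => /= ?; lra.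
by move=> x [w [W ->]] /=; apply: Rnot_lt_le => l; apply: no; exists w.
Qed.

Definition dcand p q := direct p q ++
  flat_map (fun a => map (fun b => snd a + vdist (fst a) (fst b) + snd b) (access q)) (access p).

Lemma access_nonnil p : exists a l, access p = a :: l.
Proof. by case: p => [v|e t H] /=; eexists; eexists. Qed.

Lemma In_map (A B : Type) (g : A -> B) l y :
  List.In y (map g l) <-> exists x, g x = y /\ List.In x l.
Proof.
elim: l => [|a l IH] /=; first by split=> // -[? []].
split; first by case=> [e|/IH [x [? ?]]]; [exists a | exists x]; auto.
by case=> x [e [->|i]]; [left | right; apply/IH; exists x].
Qed.

Lemma In_cat (A : Type) (l1 l2 : list A) y :
  List.In y (l1 ++ l2) <-> List.In y l1 \/ List.In y l2.
Proof. by elim: l1 => [|a l IH] /=; [tauto | rewrite IH; tauto]. Qed.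

Lemma dcandP p q y : List.In y (dcand p q) <->
  List.In y (direct p q) \/ exists a b, [/\ List.In a (access p), List.In b (access q)
    & y = snd a + vdist (fst a) (fst b) + snd b].
Proof.
rewrite /dcand In_cat in_flat_map; split=> -[h|h]; [by left| right |by left| right].
  by case: h => a [ha /In_map [b [<- hb]]]; exists a, b.
by case: h => a [b [ha hb ->]]; exists a; split=> //; apply/In_map; exists b.
Qed.

Lemma mg_dist_in p q : List.In (mg_dist p q) (dcand p q).
Proof.
have : dcand p q <> nil.
  case: (access_nonnil p) => a [l ea]; case: (access_nonnil q) => b [l' eb].
  move=> e; have /dcandP : List.In (snd a + vdist (fst a) (fst b) + snd b) (dcand p q) -> False by rewrite e.
  have : List.In (snd a + vdist (fst a) (fst b) + snd b) (dcand p q).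
    by apply/dcandP; right; exists a, b; rewrite ea eb; split=> //; left.
  by rewrite e.
rewrite /mg_dist -/(dcand p q); case: (dcand p q) => // x l _; exact: Rmin_list_in.
Qed.

Lemma mg_dist_le p q y : List.In y (dcand p q) -> mg_dist p q <= y.
Proof. by rewrite /mg_dist -/(dcand p q); case: (dcand p q) => // x l; apply: Rmin_list_le. Qed.

Lemma conn_of_lt p q L : mg_dist p q < L -> conn p q L.
Proof.
move=> h; case/dcandP: (mg_dist_in p q) => [i|[a [b [ha hb e]]]].
  by left; exists (mg_dist p q); split=> //; lra.
right; have /vdist_lt [w W l] : vdist (fst a) (fst b) < L - snd a - snd b by lra.
by exists a, b, w; split=> //; lra.
Qed.

Lemma conn_le p q L : conn p q L -> mg_dist p q <= L.
Proof.
case=> [[x [i l]]|[a [b [w [ha hb W l]]]]].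
  apply: Rle_trans l; apply: mg_dist_le; apply/dcandP; by left.
have /mg_dist_le : List.In (snd a + vdist (fst a) (fst b) + snd b) (dcand p q).
  by apply/dcandP; right; exists a, b.
have := vdist_le W; lra.
Qed.

Lemma access_ge0 p a : List.In a (access p) -> 0 <= snd a.
Proof. by case: p => [v|e t H] /=; [case=> // <- /=; lra | case=> [<-|[<-|//]] /=; lra]. Qed.

Lemma direct_ge0 p q x : List.In x (direct p q) -> 0 <= x.
Proof.
case: p q => [u|e t H] [v|e' s H'] //=; case: eqP => //= _ [] // <-; [lra | exact: Rabs_pos].
Qed.

Lemma conn_ge0 p q L : conn p q L -> 0 <= L.
Proof.
case=> [[x [/direct_ge0 i l]]|[a [b [w [/access_ge0 ha /access_ge0 hb W l]]]]]; first by lra.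
have := walk_len_ge0 w; lra.
Qed.

Lemma mg_dist_ge0 p q : 0 <= mg_dist p q.
Proof.
apply: Rnot_lt_le => h; have /conn_of_lt /conn_ge0 : mg_dist p q < mg_dist p q / 2 by lra.
lra.
Qed.

Lemma direct_sym p q x : List.In x (direct p q) -> List.In x (direct q p).
Proof.
case: p q => [u|e t H] [v|e' s H'] //=; rewrite eq_sym; case: eqP => //= _ [] // <-; left=> //.
exact: Rabs_minus_sym.
Qed.

Lemma conn_sym p q L : conn p q L -> conn q p L.
Proof.
case=> [[x [/direct_sym i l]]|[a [b [w [ha hb /walk_sym [w' W' e] l]]]]]; first by left; exists x.
by right; exists b, a, w'; split=> //; lra.
Qed.

Lemma access_walk p a b : List.In a (access p) -> List.In b (access p) ->
  exists2 w, walk a.1 b.1 w & walk_len w <= snd a + snd b.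
Proof.
case: p => [v|e t H] /=; first by case=> // <- [] // <- /=; exists nil => //=; lra.
case=> [<-|[<-|//]] [<-|[<-|//]] /=.
- by exists nil => //=; lra.
- by exists ((e, true) :: nil) => //=; lra.
- by exists ((e, false) :: nil) => //=; lra.
- by exists nil => //=; lra.
Qed.

Lemma direct_access p q x b : List.In x (direct p q) -> List.In b (access q) ->
  exists a, [/\ List.In a (access p), a.1 = b.1 & snd a <= x + snd b].
Proof.
case: p q => [u|e t H] [v|e' s H'] //=; case: eqP => // eq; subst.
  by case=> // <- [] // <- /=; exists (v, 0); split=> //=; try lra; left.
case=> // <- [<-|[<-|//]] /=.
  exists (gsrc e', t); split=> /=; [by left | by [] | have := Rle_abs (t - s); lra].
exists (gtgt e', glen e' - t); split=> /=; [by right; left | by [] |].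
rewrite Rabs_minus_sym; have := Rle_abs (s - t); lra.
Qed.

Lemma direct_trans p q z x y : List.In x (direct p q) -> List.In y (direct q z) ->
  exists2 c, List.In c (direct p z) & c <= x + y.
Proof.
case: p q => [u|e t H] [v|e' s H'] //=; case: eqP => //= e1 [] // <-; case: z => [k|e2 r Hr] //=;
  case: eqP => //= e3 [] // <-; subst.
  by rewrite eqxx; exists 0; [by left | lra].
rewrite eqxx; exists (Rabs (t - r)); first by left.
have -> : t - r = (t - s) + (s - r) by ring.
exact: Rabs_triang.
Qed.

(** If both connections run through vertices, they may reach [q] from different ends of its edge;
    walking the whole edge costs exactly the two access lengths already paid. *)
Lemma conn_trans p q z L L' : conn p q L -> conn q z L' -> conn p z (L + L').
Proof.
case=> [[x [i l]]|[a [b [w [ha hb W l]]]]] [[y [j l']]|[c [d [w' [hc hd W' l']]]]].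
- by have [k ik kl] := direct_trans i j; left; exists k; split=> //; lra.
- have [a [ha ea la]] := direct_access i hc; right; exists a, d, w'; split=> //; [by rewrite ea | lra].
- have [d [hd ed ld]] := direct_access (direct_sym j) hb.
  by right; exists a, d, w; split=> //; [rewrite ed | lra].
have [w2 W2 l2] := access_walk hb hc; right; exists a, d, (w ++ w2 ++ w'); split=> //.
  by apply: walk_cat W (walk_cat W2 W').
rewrite !walk_len_cat; lra.
Qed.

Lemma conn_refl p : conn p p 0.
Proof.
by left; exists 0; case: p => [v|e t H] /=; rewrite eqxx; split; try lra; left=> //;
  rewrite Rminus_diag Rabs_R0.
Qed.

Lemma mg_dist_sym p q : mg_dist p q = mg_dist q p.
Proof.
have le p' q' : mg_dist p' q' <= mg_dist q' p'.
  apply: le_epsilon => e e0; apply: conn_le; apply: conn_sym; apply: conn_of_lt; lra.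
by apply: Rle_antisym.
Qed.

Lemma mg_dist_triangle p q z : mg_dist p z <= mg_dist p q + mg_dist q z.
Proof.
apply: le_epsilon => e e0.
have -> : mg_dist p q + mg_dist q z + e = (mg_dist p q + e/2) + (mg_dist q z + e/2) by field.
apply: conn_le; apply: (@conn_trans _ q); apply: conn_of_lt; lra.
Qed.

Lemma mg_dist_refl p : mg_dist p p = 0.
Proof. by apply: Rle_antisym; [apply: conn_le; apply: conn_refl | apply: mg_dist_ge0]. Qed.

End MetricGraph.

(** * Correspondences and the Gromov-Hausdorff distance *)

Section GromovHausdorff.
Variables (T1 T2 : Type) (d1 : T1 -> T1 -> R) (d2 : T2 -> T2 -> R).

Definition distortion_le (C : T1 -> T2 -> Prop) (eta : R) :=
  forall x y x' y', C x y -> C x' y' -> Rabs (d1 x x' - d2 y y') <= eta.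

Lemma dGH_lt_inv c : Rbar_lt (dGH d1 d2) (Rbar.Finite c) ->
  exists eta C, [/\ eta < 2 * c, correspondence C & distortion_le C eta].
Proof.
rewrite /dGH; set S := (fun eta => _) => h.
have [lb gr] := Glb_Rbar_correct S; apply: NNPP => no.
have lb2 : is_lb_Rbar S (Rbar.Finite (2 * c)).
  move=> x [x0 [C [hC dC]]] /=; apply: Rnot_lt_le => l; apply: no; exists x, C; split=> //.
have := gr _ lb2; move: h; case: (Glb_Rbar S) => [y||] //=; first by lra.
by case: Rle_dec => [?|]; [case: Rle_lt_or_eq_dec => //; lra | lra].
Qed.

Lemma dGH_lt c eta C : 0 <= eta -> eta < 2 * c -> correspondence C -> distortion_le C eta ->
  Rbar_lt (dGH d1 d2) (Rbar.Finite c).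
Proof.
rewrite /dGH; set S := (fun eta => _) => e0 ec hC dC.
have [lb gr] := Glb_Rbar_correct S.
have Se : S eta by split=> //; exists C.
have lb0 : is_lb_Rbar S (Rbar.Finite 0) by move=> x [].
have := lb _ Se; have := gr _ lb0; case: (Glb_Rbar S) => [y||] //=; lra.
Qed.

End GromovHausdorff.

(** * Positions on an edge measured from either end *)

Section Arms.
Variable M : fgraph.
Implicit Types (e : gE M) (o : bool) (p q : mg_point M).

Definition edge_end o e : gV M := if o then gsrc e else gtgt e.

(* The flag [o] tells from which end of [e] the position [t] is measured. *)
Definition arm o e t p : Prop :=
  exists H : 0 < (if o then t else glen e - t) < glen e, p = MPe H.

Lemma arm_bounds o e t p : arm o e t p -> 0 < t < glen e.
Proof. by case=> H _; move: H; case: o; lra. Qed.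

Lemma arm_flip o e t p : arm o e t p -> arm (~~ o) e (glen e - t) p.
Proof.
case; case: o => /= H ->; rewrite /arm /=; last by exists H.
have e1 : glen e - (glen e - t) = t by ring.
by rewrite e1; exists H.
Qed.

Lemma MPe_eq e t s (H : 0 < t < glen e) (H' : 0 < s < glen e) : t = s -> MPe H = MPe H'.
Proof. by move=> ts; subst; congr MPe; apply: proof_irrelevance. Qed.

Lemma arm_exists o e t : 0 < t < glen e -> exists p, arm o e t p.
Proof.
move=> h; have H : 0 < (if o then t else glen e - t) < glen e by case: o; lra.
by exists (MPe H); exists H.
Qed.

Lemma arm_uniq o e t p q : arm o e t p -> arm o e t q -> p = q.
Proof. by move=> [H ->] [H' ->]; apply: MPe_eq. Qed.

Lemma arm_inj o o' e e' t t' p : arm o e t p -> arm o' e' t' p ->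
  e = e' /\ t' = (if o == o' then t else glen e - t).
Proof. by move=> [H ->] [H' [ee tt]]; subst; split=> //; move: tt; case: o H; case: o' H' => /=; lra. Qed.

Lemma arm_same o e t t' p : arm o e t p -> arm o e t' p -> t = t'.
Proof. by move=> h1 h2; have [_ ->] := arm_inj h1 h2; rewrite eqxx. Qed.

Lemma arm_access o e t p : arm o e t p ->
  List.In (edge_end o e, t) (access p) /\ List.In (edge_end (~~ o) e, glen e - t) (access p).
Proof.
move=> [H ->] /=; case: o H => /= H; first by split; [left | right; left].
split; [right; left | by left]; congr pair; ring.
Qed.

Lemma access_arm o e t p a : arm o e t p -> List.In a (access p) ->
  a = (edge_end o e, t) \/ a = (edge_end (~~ o) e, glen e - t).
Proof.
move=> [H ->] /=; case: o H => /= H [<-|[<-|//]]; [by left|by right|by right|left].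
congr pair; ring.
Qed.

Lemma arm_direct o e t s p q : arm o e t p -> arm o e s q -> List.In (Rabs (t - s)) (direct p q).
Proof.
move=> [H ->] [H' ->] /=; rewrite eqxx; left; case: o H H' => //= _ _.
rewrite Rabs_minus_sym; congr Rabs; ring.
Qed.

Lemma direct_arm o e t p q x : arm o e t p -> List.In x (direct p q) ->
  exists2 s, arm o e s q & x = Rabs (t - s).
Proof.
move=> ap; move: (ap) => [H pe]; case: q => [v|e' s H']; subst p => //=; case: eqP => // ee; subst e'.
case=> // <-; case: o H ap => /= H ap.
  by exists s => //; exists H'.
exists (glen e - s); last by rewrite Rabs_minus_sym; congr Rabs; ring.
have e1 : glen e - (glen e - s) = s by ring.
by rewrite /arm /= e1; exists H'.
Qed.

Lemma direct_vertex v q x : List.In x (direct (MPv v) q) -> q = MPv v /\ x = 0.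
Proof. by case: q => [u|e s H] //=; case: eqP => // ->; case=> // <-. Qed.

Lemma mg_pointP p : (exists v, p = MPv v) \/ (exists e t, arm true e t p).
Proof. by case: p => [v|e t H]; [left; exists v | right; exists e, t; exists H]. Qed.

Lemma access_vertex (v : gV M) a : List.In a (access (MPv v)) -> a = (v, 0).
Proof. by case=> // <-. Qed.

End Arms.

Section ArmDist.
Variable M : fgraph.
Hypothesis posM : mg_positive M.
Hypothesis connM : mg_connected M.

Lemma dist_access (p : mg_point M) a : List.In a (access p) -> mg_dist p (MPv a.1) <= a.2.
Proof.
move=> h; apply: conn_le => //; right; exists a, (a.1, 0), nil; split=> //=; [by left | lra].
Qed.

Lemma dist_arm o e t (p : mg_point M) : arm o e t p -> mg_dist p (MPv (edge_end o e)) <= t.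
Proof. by case/arm_access => /dist_access. Qed.

Lemma dist_arm2 o e t s (p q : mg_point M) : arm o e t p -> arm o e s q -> mg_dist p q <= Rabs (t - s).
Proof. by move=> h1 h2; apply: conn_le => //; left; exists (Rabs (t - s)); split; [exact: arm_direct h1 h2 | lra]. Qed.

Lemma dist_walk (u v : gV M) w : walk u v w -> mg_dist (MPv u) (MPv v) <= walk_len w.
Proof.
by move=> W; apply: conn_le => //; right; exists (u, 0), (v, 0), w; split=> //=; [left|left|lra].
Qed.

End ArmDist.

(** * Geodesics in compact path metric spaces *)

(** Real induction from 1 down to 0: the infimum of the points where [S] holds satisfies [S] by one
    direction of the local transfer and must be 0 by the other. It replaces a uniform subdivision of
    [0, 1] for a curve. *)
Lemma unit_interval_ind (S : R -> Prop) : S 1 ->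
  (forall t, unit_interval t -> exists del, 0 < del /\ forall s, unit_interval s -> Rabs (s - t) < del ->
     (t <= s -> S s -> S t) /\ (s <= t -> S t -> S s)) -> S 0.
Proof.
move=> S1 loc; pose E x := exists t, [/\ unit_interval t, S t & x = 1 - t].
have u1 : unit_interval 1 by rewrite /unit_interval; lra.
have [m [ub lub]] : {m | is_lub E m}.
  apply: completeness; first by exists 1 => x [t [[? ?] _ ->]]; lra.
  by exists 0, 1; split=> //; lra.
have m0 : 0 <= m by apply: ub; exists 1; split=> //; lra.
have m1 : m <= 1 by apply: lub => x [t [[? ?] _ ->]]; lra.
have um : unit_interval (1 - m) by rewrite /unit_interval; lra.
have [del [d0 hd]] := loc _ um.
have Sm : S (1 - m).
  have [t [[t0 t1] St tm]] : exists t, [/\ unit_interval t, S t & 1 - t > m - del].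
    apply: NNPP => no; have /lub : is_upper_bound E (m - del); last by lra.
    by move=> x [t [ut St ->]]; apply: Rnot_lt_le => l; apply: no; exists t; split=> //; lra.
  have tm2 : 1 - t <= m by apply: ub; exists t.
  have [] := hd t; first by split.
    by rewrite Rabs_pos_eq; lra.
  by move=> h _; apply: h => //; lra.
have [m1'|m1'] := Req_dec m 1; first by have := Sm; rewrite m1' Rminus_diag.
exfalso; set s := Rmax 0 (1 - m - del / 2).
have [s0 s1] : 0 <= s /\ 1 - m - del / 2 <= s by split; [apply: Rmax_l | apply: Rmax_r].
have sm : s < 1 - m by apply: Rmax_lub_lt; lra.
have us : unit_interval s by rewrite /unit_interval; lra.
have [] := hd s us; first by rewrite Rabs_left; lra.
move=> _ /(_ (Rlt_le _ _ sm) Sm) Ss; have : 1 - s <= m by apply: ub; exists s.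
lra.
Qed.

Section PathSpace.
Variables (X : Type) (dX : X -> X -> R).
Hypothesis mX : is_metric dX.

Lemma d_refl x : dX x x = 0. Proof. by case: mX => h _; apply/h. Qed.
Lemma d_eq0 x y : dX x y = 0 -> x = y. Proof. by case: mX => h _ /h. Qed.
Lemma d_sym x y : dX x y = dX y x. Proof. by case: mX => _ []. Qed.
Lemma d_tri x y z : dX x z <= dX x y + dX y z. Proof. by case: mX => _ [_]. Qed.
Lemma d_ge0 x y : 0 <= dX x y.
Proof. have := d_tri x y x; rewrite d_refl (d_sym y); lra. Qed.

Lemma d_abs x y z : Rabs (dX x y - dX x z) <= dX y z.
Proof.
apply: Rabs_le; have := d_tri x y z; have := d_tri x z y; rewrite (d_sym z y); lra.
Qed.

Lemma metric_open_gt (h : X -> R) K c : (forall x y, Rabs (h x - h y) <= K * dX x y) ->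
  open_in dX (fun x => c < h x).
Proof.
move=> lip x hx; set K1 := Rmax K 1.
have K1p : 1 <= K1 by apply: Rmax_r.
have KK1 : K <= K1 by apply: Rmax_l.
exists ((h x - c) / K1); split; first by apply: Rdiv_lt_0_compat; lra.
move=> y l; have l2 : K1 * dX x y < h x - c.
  by have := Rmult_lt_compat_l K1 _ _ ltac:(lra) l; have -> : K1 * ((h x - c) / K1) = h x - c by field; lra.
have := lip x y; have := Rabs_def2 (h x - h y) (h x - c).
have := d_ge0 x y => p; have : K * dX x y <= K1 * dX x y by apply: Rmult_le_compat_r.
move=> q h1 h2; case: h1; lra.
Qed.

Hypothesis cX : compact_space dX.

Lemma list_inv_bound (l : list nat) : exists eta, 0 < eta /\ forall n, List.In n l -> eta <= / INR n.+1.
Proof.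
elim: l => [|n l [eta [e0 h]]]; first by exists 1; split=> //; lra.
exists (Rmin eta (/ INR n.+1)); split.
  by apply: Rmin_pos => //; apply: Rinv_0_lt_compat; apply: lt_0_INR; lia.
move=> k [<-|i]; first exact: Rmin_r.
exact: Rle_trans (Rmin_l _ _) (h _ i).
Qed.

Lemma inv_nat_lt x : 0 < x -> exists n, / INR n.+1 < x.
Proof.
move=> x0; have [[|n] [hn n0]] := archimed_cor1 x x0; first by lia.
by exists n.
Qed.

(** Were [h] positive everywhere, the open sets h > 1 / (n + 1) would cover the space, and a finite
    subcover would keep [h] away from 0. *)
Lemma compact_zero (h : X -> R) K : (forall x y, Rabs (h x - h y) <= K * dX x y) ->
  (forall eta, 0 < eta -> exists x, h x < eta) -> exists x, h x <= 0.
Proof.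
move=> lip small; apply: NNPP => no.
have [|x|l hl] := cX (U := fun n x => / INR n.+1 < h x).
- by move=> n; apply: metric_open_gt lip.
- apply: inv_nat_lt; apply: Rnot_le_lt => l; apply: no; by exists x.
have [eta [e0 he]] := list_inv_bound l.
have [x hx] := small _ e0; have [n [i hn]] := hl x; have := he _ i; lra.
Qed.

Hypothesis pX : path_metric dX.

(** A 1-Lipschitz retraction onto [0, 1]: it extends a curve, known to be continuous only on [0, 1],
    to a continuous function on R, as [IVT_cor] requires. *)
Definition clamp (t : R) := Rmax 0 (Rmin 1 t).

Lemma clamp_unit t : unit_interval (clamp t).
Proof.
rewrite /clamp /unit_interval; split; first exact: Rmax_l.
by apply: Rmax_lub; [lra | exact: Rmin_l].
Qed.

Lemma clampK t : unit_interval t -> clamp t = t.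
Proof. by rewrite /clamp => -[h0 h1]; rewrite Rmin_right // Rmax_right. Qed.

Lemma clamp_lip s t : Rabs (clamp s - clamp t) <= Rabs (s - t).
Proof.
have cases x : (x <= 0 /\ clamp x = 0) \/ (1 <= x /\ clamp x = 1) \/ (0 <= x <= 1 /\ clamp x = x).
  rewrite /clamp; case: (Rle_dec x 0) => h0; first by left; rewrite Rmin_right ?Rmax_left //; lra.
  case: (Rle_dec 1 x) => h1; first by right; left; rewrite Rmin_left ?Rmax_right //; lra.
  by right; right; rewrite Rmin_right ?Rmax_right; lra.
case: (cases s) => [|[|]] [hs ->]; case: (cases t) => [|[|]] [ht ->];
  rewrite /Rabs; do ?[case: Rcase_abs => ?]; lra.
Qed.

Lemma curve_IVT (g : R -> X) r c : cont_on_I dX g -> dX r (g 0) <= c -> c <= dX r (g 1) ->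
  exists2 t, unit_interval t & dX r (g t) = c.
Proof.
move=> cg c0 c1; pose f t := dX r (g (clamp t)) - c.
have u0 : unit_interval 0 by rewrite /unit_interval; lra.
have u1 : unit_interval 1 by rewrite /unit_interval; lra.
have cf : Ranalysis1.continuity f.
  move=> t eps e0; have [del [d0 h]] := cg _ (clamp_unit t) eps e0.
  exists del; split=> // s [_ /= hs]; rewrite /R_dist /f in hs *.
  apply: Rle_lt_trans (h (clamp s) (clamp_unit s) _); last exact: Rle_lt_trans (clamp_lip _ _) hs.
  have -> : dX r (g (clamp s)) - c - (dX r (g (clamp t)) - c) = dX r (g (clamp s)) - dX r (g (clamp t)) by ring.
  exact: d_abs.
have [||z [[z0 z1] fz]] := IVT_cor f 0 1 cf; first by lra.
  by rewrite /f !clampK //; nra.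
by exists z; [split | move: fz; rewrite /f clampK //; lra].
Qed.

(** On a nearly shortest curve from [r] to [y], a point of the right height is nearly at distance
    [s] from [y]. The function [h] adds the errors in both equations, so compactness turns these
    points into an exact one, without constructing a geodesic. *)
Lemma descent r y s : 0 <= s <= dX r y -> exists2 z, dX r z = dX r y - s & dX y z = s.
Proof.
move=> [s0 s1]; pose h z := Rabs (dX r z - (dX r y - s)) + Rabs (dX y z - s).
have [|eta e0|z hz] := @compact_zero h 2.
- move=> x1 x2; rewrite /h.
  have := d_abs r x1 x2; have := d_abs y x1 x2; have := d_ge0 x1 x2.
  rewrite /Rabs; do ?[case: Rcase_abs => ?]; lra.
- have [_ /(_ eta e0) [g [L [[cg [g0 g1]] [lg Ll]]]]] := pX r y.
  have [t [t0 t1] ht] : exists2 t, unit_interval t & dX r (g t) = dX r y - s.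
    by apply: curve_IVT => //; rewrite ?g0 ?g1 ?d_refl; lra.
  have := lg (0 :: t :: 1 :: nil); rewrite /= g0 g1 => ln.
  have {}ln : dX r (g t) + (dX (g t) y + 0) <= L.
    apply: ln; first by do 3![constructor => //]; try constructor.
    by do 3![constructor => //; try by rewrite /unit_interval; lra].
  exists (g t); rewrite /h ht Rminus_diag Rabs_R0 (d_sym y).
  have tri := d_tri r (g t) y; rewrite Rabs_pos_eq; lra.
exists z; move: hz; rewrite /h; have := Rabs_pos (dX r z - (dX r y - s));
  have := Rabs_pos (dX y z - s); rewrite /Rabs; do ?[case: Rcase_abs => ?]; lra.
Qed.

Inductive chain (P : X -> Prop) (del : R) : X -> X -> Prop :=
| chain_one x : P x -> chain P del x x
| chain_step x y z : P x -> dX x y <= del -> chain P del y z -> chain P del x z.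

Lemma curve_chain (P : X -> Prop) del (g : R -> X) : cont_on_I dX g ->
  (forall t, unit_interval t -> P (g t)) -> 0 < del -> chain P del (g 0) (g 1).
Proof.
move=> cg Pg d0; apply: (unit_interval_ind (S := fun t => chain P del (g t) (g 1))).
  by apply: chain_one; apply: Pg; rewrite /unit_interval; lra.
move=> t ut; have [eta [e0 h]] := cg t ut del d0; exists eta; split=> // s us st.
have := h s us st => l; split=> _ c; apply: chain_step c; try exact: Pg; first by rewrite d_sym; lra.
lra.
Qed.

Lemma chain_P P del x y : chain P del x y -> P x /\ P y.
Proof. by elim=> // {}x {}y z Px _ _ []. Qed.

(** Along a nearly shortest curve, real induction from its end [y] builds a subdivision fine enough
    for the local estimate; its polygonal length is at most that of the curve. *)
Lemma lipschitz_of_local (T : Type) (dT : T -> T -> R) (F : X -> T) :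
  (forall p, dT p p = 0) -> (forall p q z, dT p z <= dT p q + dT q z) ->
  (forall p q, dT p q = dT q p) ->
  (forall x, exists e, 0 < e /\ forall y, dX x y < e -> dT (F x) (F y) <= dX x y) ->
  forall x y, dT (F x) (F y) <= dX x y.
Proof.
move=> T0 Tt Ts loc x y; apply: le_epsilon => eta e0.
have [_ /(_ eta e0) [g [L [[cg [g0 g1]] [lg Ll]]]]] := pX x y.
have u1 : unit_interval 1 by rewrite /unit_interval; lra.
pose S t := exists l, [/\ Sorted Rle (t :: l), List.Forall unit_interval (t :: l) &
  dT (F (g t)) (F y) <= chain_len dX g (t :: l)].
have : S 0.
  apply: unit_interval_ind.
    by exists nil; split; [by constructor; constructor | by constructor | rewrite g1 T0 /=; lra].
  move=> t ut; have [e [ep he]] := loc (g t).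
  have [del [d0 h]] := cg t ut e ep; exists del; split=> // s us st.
  have dts := he (g s) ltac:(by rewrite d_sym; apply: h).
  have e1 := Ts (F (g s)) (F (g t)); have e2 := d_sym (g s) (g t).
  split=> ts [l [sl ul ll]]; [exists (s :: l) | exists (t :: l)]; split; try by constructor.
  - by constructor => //; constructor.
  - by move: ll (Tt (F (g t)) (F (g s)) (F y)) => /=; lra.
  - by constructor => //; constructor.
  - by move: ll (Tt (F (g s)) (F (g t)) (F y)) => /=; lra.
case=> l [sl ul ll]; have := lg _ sl ul; rewrite g0 in ll; lra.
Qed.

End PathSpace.

(** * Lifting paths of the Reeb graph *)

Lemma finite_pos_bound (T : finType) (h : T -> R) : (forall e, 0 < h e) ->
  exists2 m, 0 < m & forall e, m <= h e.
Proof.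
move=> h0; suff [m m0 hm] : exists2 m, 0 < m & forall e, e \in enum T -> m <= h e.
  by exists m => // e; apply: hm; rewrite mem_enum.
elim: (enum T) => [|e l [m m0 hm]]; first by exists 1; [lra |].
exists (Rmin m (h e)); first exact: Rmin_pos.
move=> k; rewrite inE => /orP[/eqP ->|/hm l']; [exact: Rmin_r | exact: Rle_trans (Rmin_l _ _) l'].
Qed.

Section VertexStar.
Variable M : fgraph.
Hypothesis posM : mg_positive M.
Hypothesis connM : mg_connected M.

Lemma walk_len_ge (w : list (gE M * bool)) m : (forall e : gE M, m <= glen e) -> w <> nil -> m <= walk_len w.
Proof. case: w => [|[e b] w] h // _; move: (h e) (walk_len_ge0 posM w) => /= h1 h2. lra. Qed.

Lemma dist_vertex_star m v (q : mg_point M) : (forall e : gE M, m <= glen e) -> mg_dist (MPv v) q < m ->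
  q = MPv v \/ exists o e t, edge_end o e = v /\ arm o e t q.
Proof.
move=> hm lt; have : mg_dist (MPv v) q < (mg_dist (MPv v) q + m) / 2 by lra.
case/(conn_of_lt posM connM) => [[x [/direct_vertex [-> _] _]]|]; first by left.
case=> a [b [w [/access_vertex -> hb W l]]].
have w0 : w = nil.
  by apply: NNPP => /(walk_len_ge hm); have := access_ge0 hb; move: l => /=; lra.
move: W; rewrite w0 /= => vb; case: (mg_pointP q) => [[u e]|[e [t a1]]].
  by left; move: hb; rewrite e => /access_vertex hb; rewrite vb hb.
right; case: (access_arm a1 hb) => hb'; subst b; first by exists true, e, t.
by exists false, e, (glen e - t); split; [rewrite vb | exact: (arm_flip a1)].
Qed.

Lemma dist_arm_star o e t (p q : mg_point M) : arm o e t p -> mg_dist p q < Rmin t (glen e - t) ->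
  exists s, arm o e s q.
Proof.
move=> a1; set m := Rmin _ _ => lt; have : mg_dist p q < (mg_dist p q + m) / 2 by lra.
case/(conn_of_lt posM connM) => [[x [/(direct_arm a1) [s a2 _] _]]|]; first by exists s.
case=> a [b [w [/(access_arm a1) ha /access_ge0 hb _ l]]].
have := walk_len_ge0 posM w; have := Rmin_l t (glen e - t); have := Rmin_r t (glen e - t).
by move: l lt; rewrite /m; case: ha => -> /=; lra.
Qed.
End VertexStar.

Section ReebMap.
Variables (X : Type) (dX : X -> X -> R) (r : X) (M : fgraph) (Pi : X -> mg_point M) (f : mg_point M -> R)
  (vr : gV M).
Hypotheses (mX : is_metric dX) (cX : compact_space dX) (pX : path_metric dX).
Hypotheses (posM : mg_positive M) (connM : mg_connected M).
Hypothesis fPi : forall x, f (Pi x) = dX r x.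
Hypothesis Pi_surj : forall p, exists x, Pi x = p.
Hypothesis f_edge : forall e t t' p p', on_edge e t p -> on_edge e t' p' -> Rabs (t - t') = Rabs (f p - f p').
Hypothesis Pi_cont : forall U, open_in (@mg_dist M) U -> open_in dX (fun x => U (Pi x)).
Hypothesis Pi_root : Pi r = MPv vr.

Implicit Types (e : gE M) (u v : gV M) (p q z : mg_point M).

Definition low e : bool := if Rlt_dec (f (MPv (gsrc e))) (f (MPv (gtgt e))) then true else false.
Definition bot e := edge_end (low e) e.
Definition top e := edge_end (~~ low e) e.

Lemma on_edge_src e : on_edge e 0 (MPv (gsrc e)). Proof. by left. Qed.
Lemma on_edge_tgt e : on_edge e (glen e) (MPv (gtgt e)). Proof. by right; left. Qed.

Lemma on_edge_arm e t p : arm true e t p -> on_edge e t p.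
Proof. by case=> H ->; right; right; exists H. Qed.

Lemma f_top e : f (MPv (top e)) = f (MPv (bot e)) + glen e.
Proof.
have := f_edge (on_edge_src e) (on_edge_tgt e); have := posM e; rewrite /top /bot /low.
by case: Rlt_dec => /= ?; rewrite /Rabs; do 2![case: Rcase_abs => ?]; lra.
Qed.

Lemma f_arm e t p : arm (low e) e t p -> f p = f (MPv (bot e)) + t.
Proof.
move=> a; have [p0 p1] := arm_bounds a; have /= := f_top e; rewrite /top /bot /low in a *.
move: a; case: Rlt_dec => h a.
  have := f_edge (on_edge_src e) (on_edge_arm a); have := f_edge (on_edge_tgt e) (on_edge_arm a).
  by rewrite /edge_end /= /Rabs; do ?[case: Rcase_abs => ?]; lra.
have := f_edge (on_edge_src e) (on_edge_arm (arm_flip a)).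
have := f_edge (on_edge_tgt e) (on_edge_arm (arm_flip a)).
by rewrite /edge_end /= /Rabs; do ?[case: Rcase_abs => ?]; lra.
Qed.

(* Unlike in [on_edge], the position is not recorded: [f] determines it. *)
Definition on e p := p = MPv (bot e) \/ p = MPv (top e) \/ exists t, arm (low e) e t p.

Lemma arm_on o e t p : arm o e t p -> on e p.
Proof.
move=> a; right; right; case: (boolP (o == low e)) => [/eqP <-|ne]; first by exists t.
exists (glen e - t); have -> : low e = ~~ o by case: (o) (low e) ne => [] [].
exact: arm_flip.
Qed.

Lemma on_bounds e p : on e p -> f (MPv (bot e)) <= f p <= f (MPv (top e)).
Proof.
have h := posM e; rewrite f_top => -[->|[->|[t a]]]; rewrite ?f_top; try lra.
by rewrite (f_arm a); have := arm_bounds a; lra.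
Qed.

Lemma on_end o e : on e (MPv (edge_end o e)).
Proof.
rewrite /on /bot /top; case: (boolP (o == low e)) => [/eqP ->|ne]; first by left.
by right; left; congr MPv; case: (o) (low e) ne => [] [].
Qed.

Lemma on_inj e p q : on e p -> on e q -> f p = f q -> p = q.
Proof.
have h := posM e; have ft := f_top e.
case=> [->|[->|[t a]]] [->|[->|[s b]]] //; rewrite ?ft ?(f_arm a) ?(f_arm b) => E;
  try (by exfalso; move: E; try have := arm_bounds a; try have := arm_bounds b; lra).
by have ts : t = s by [lra]; subst s; exact: arm_uniq a b.
Qed.

Lemma on_exists e c : f (MPv (bot e)) <= c <= f (MPv (top e)) -> exists2 p, on e p & f p = c.
Proof.
rewrite f_top => -[h1 h2]; have [E|n1] := Req_dec c (f (MPv (bot e))); first by exists (MPv (bot e)); [left |].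
have [E|n2] := Req_dec c (f (MPv (top e))); first by exists (MPv (top e)); [right; left |].
rewrite f_top in n2; have [|p a] := @arm_exists M (low e) e (c - f (MPv (bot e))); first by lra.
by exists p; [exact: arm_on a | rewrite (f_arm a); ring].
Qed.

Lemma on_dist e p q : on e p -> on e q -> mg_dist p q <= Rabs (f p - f q).
Proof.
have le p' q' : on e p' -> on e q' -> f p' <= f q' -> mg_dist p' q' <= f q' - f p'.
  have ft := f_top e; have le0 := posM e.
  have be : mg_dist (MPv (bot e)) (MPv (top e)) <= glen e.
    apply: conn_le => //; right; exists (bot e, 0), (top e, 0), ((e, low e) :: nil).
    by rewrite /top /bot; case: (low e); split=> //=; try (by left); lra.
  case=> [->|[->|[t a]]] [->|[->|[s b]]]; rewrite ?ft ?(f_arm a) ?(f_arm b) => l;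
    rewrite ?mg_dist_refl //; try (have [a0 a1] := arm_bounds a); try (have [b0 b1] := arm_bounds b); try lra.
  - by rewrite mg_dist_sym //; have := dist_arm posM connM b; rewrite /bot; lra.
  - have := dist_arm posM connM (arm_flip a); rewrite /top; lra.
  - by have := dist_arm2 posM connM a b; rewrite /Rabs; case: Rcase_abs; lra.
move=> hp hq; rewrite /Rabs; case: Rcase_abs => h; first by have := le _ _ hp hq; lra.
by rewrite mg_dist_sym //; have := le _ _ hq hp; lra.
Qed.

Lemma f_end_arm o e t p : arm o e t p -> Rabs (f p - f (MPv (edge_end o e))) = t.
Proof.
move=> a; have := f_top e; rewrite /top /bot; case: (boolP (o == low e)) => [/eqP E|ne].
  by move: a; rewrite E => a; rewrite (f_arm a) /bot => _; have := arm_bounds a; rewrite /Rabs; case: Rcase_abs; lra.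
have lo : low e = ~~ o by case: (o) (low e) ne => [] [].
have := arm_flip a; rewrite -lo => b; rewrite (f_arm b) /bot lo negbK => ->.
by have := arm_bounds a; rewrite /Rabs; case: Rcase_abs; lra.
Qed.

Lemma f_access p a : List.In a (access p) -> Rabs (f p - f (MPv a.1)) = a.2.
Proof.
case: (mg_pointP p) => [[v ->]|[e [t h]]]; first by move/access_vertex => -> /=; rewrite Rminus_diag Rabs_R0.
by case/(access_arm h) => -> /=; [exact: f_end_arm h | exact: f_end_arm (arm_flip h)].
Qed.

Lemma f_walk u v w : walk u v w -> Rabs (f (MPv u) - f (MPv v)) <= walk_len w.
Proof.
elim: w u => [|[e b] w IH] u /=; first by move=> ->; rewrite Rminus_diag Rabs_R0; lra.
have := f_edge (on_edge_src e) (on_edge_tgt e); have p := posM e.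
rewrite (_ : Rabs (0 - glen e) = glen e); last by rewrite /Rabs; case: Rcase_abs; lra.
by move=> E; case: b => -[<- /IH]; move: E; rewrite /Rabs; do ?[case: Rcase_abs => ?]; lra.
Qed.

Lemma f_lip p q : Rabs (f p - f q) <= mg_dist p q.
Proof.
apply: le_epsilon => eta e0; have : mg_dist p q < mg_dist p q + eta by lra.
case/(conn_of_lt posM connM) => [[x [i l]]|[a [b [w [/f_access ha /f_access hb /f_walk W l]]]]].
  suff : Rabs (f p - f q) <= x by lra.
  case: (mg_pointP p) i => [[v ->]|[e [t h]]]; first by case/direct_vertex => -> ->; rewrite Rminus_diag Rabs_R0; lra.
  case/(direct_arm h) => s b ->; have := f_edge (on_edge_arm h) (on_edge_arm b); lra.
move: ha hb W; rewrite /Rabs; do ?[case: Rcase_abs => ?]; lra.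
Qed.

(** Open edges and stars of vertices are open, so by continuity points near [x] have images sharing
    a closed edge with [Pi x]. On one edge the graph distance is a difference of heights, which [dX]
    dominates; the path metric makes this global. *)
Lemma Pi_lip x y : mg_dist (Pi x) (Pi y) <= dX x y.
Proof.
have [m m0 hm] := finite_pos_bound posM.
apply: (lipschitz_of_local mX pX (dT := @mg_dist M)).
- exact: mg_dist_refl. - exact: mg_dist_triangle. - exact: mg_dist_sym.
move=> {}x; pose U q := q = Pi x \/ exists2 e, on e (Pi x) & on e q.
suff [e [e0 he]] : exists e : R, 0 < e /\ forall y, dX x y < e -> U (Pi y).
  exists e; split=> // {}y /he [->|[k k1 k2]]; first by rewrite mg_dist_refl //; exact: d_ge0.
  apply: Rle_trans (on_dist k1 k2) _; rewrite !fPi; exact: d_abs.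
case: (mg_pointP (Pi x)) => [[v vx]|[e [t a]]].
  have op : open_in (@mg_dist M) (fun q => q = MPv v \/ exists o e t, edge_end o e = v /\ arm o e t q).
    move=> q [->|[o [e [t [ev a]]]]]; first by exists m; split=> // z; apply: dist_vertex_star.
    have := arm_bounds a; exists (Rmin t (glen e - t)); split; first by apply: Rmin_pos; lra.
    by move=> z /(dist_arm_star posM connM a) [s b]; right; exists o, e, s.
  have [|e [e0 he]] := Pi_cont op (x := x); first by left.
  exists e; split=> // {}y /he [->|[o [k [t [ev a]]]]]; first by left.
  by right; exists k; [rewrite vx -ev; exact: on_end | exact: arm_on a].
have op : open_in (@mg_dist M) (fun q => exists s, arm true e s q).
  move=> q [s b]; have := arm_bounds b; exists (Rmin s (glen e - s)); split; first by apply: Rmin_pos; lra.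
  by move=> z /(dist_arm_star posM connM b).
have [|k [k0 hk]] := Pi_cont op (x := x); first by exists t.
by exists k; split=> // {}y /hk [s b]; right; exists e; [exact: arm_on a | exact: arm_on b].
Qed.

Lemma end_bot o e : edge_end o e = bot e -> edge_end (~~ o) e = top e.
Proof.
rewrite /top; case: (boolP (o == low e)) => [/eqP -> //|ne] E.
have : top e = bot e by rewrite -E /top; case: (o) (low e) ne => [] [].
by have := f_top e; have := posM e; move=> p F E'; move: F; rewrite E'; lra.
Qed.

Lemma end_top o e : edge_end o e = top e -> edge_end (~~ o) e = bot e.
Proof.
rewrite /bot; case: (boolP (o == ~~ low e)) => [/eqP ->|ne] E; first by rewrite negbK.
have : bot e = top e by rewrite -E /bot; case: (o) (low e) ne => [] [].
by have := f_top e; have := posM e; move=> p F E'; move: F; rewrite E'; lra.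
Qed.

(** * Forks, and lifts of descending segments *)

Definition isfork v : bool := (1 < #|[pred e | top e == v]|)%N.

Definition forkp p : bool := if p is MPv v then isfork v else false.

Lemma top_uniq v e e' : ~~ isfork v -> top e = v -> top e' = v -> e = e'.
Proof.
rewrite /isfork -leqNgt => /card_le1P h te te'; have /h /(_ e') : e \in [pred e | top e == v] by rewrite inE te.
by rewrite !inE te' eqxx => /esym /eqP.
Qed.

Lemma on_vertex e v : on e (MPv v) -> v = bot e \/ v = top e.
Proof. by case=> [[->]|[[->]|[t [H //]]]]; [left | right]. Qed.

Lemma down_uniq e e' p q z : ~~ forkp p -> on e p -> on e q -> f q < f p ->
  on e' p -> on e' z -> f z < f p -> e = e'.
Proof.
move=> nf e1 /on_bounds e2 l1 e3 /on_bounds e4 l2.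
case: (mg_pointP p) => [[v pv]|[k [t a]]]; last first.
  have u j : on j p -> j = k.
    case=> [jp|[jp|[s b]]]; first by case: a => H; rewrite jp.
      by case: a => H; rewrite jp.
    by case: (arm_inj b a).
  by rewrite (u _ e1) (u _ e3).
subst p; case: (on_vertex e1) e2 l1 => v1; first by rewrite v1; lra.
case: (on_vertex e3) e4 l2 => v2; first by rewrite v2; lra.
by move=> _ _ _ _; apply: (top_uniq nf).
Qed.

(** Gives a threshold below which the last piece of a connection to [q] must be empty. *)
Lemma access_pos_or_vertex q : exists2 m, 0 < m & forall b, List.In b (access q) ->
  b.2 < m -> b.2 = 0 /\ q = MPv b.1.
Proof.
case: (mg_pointP q) => [[v ->]|[e [t a]]]; first by exists 1; [lra | move=> b /access_vertex ->].
have ab := arm_bounds a; exists (Rmin t (glen e - t)); first by apply: Rmin_pos; lra.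
move=> b /(access_arm a) h; have := Rmin_l t (glen e - t); have := Rmin_r t (glen e - t).
by case: h => -> /=; lra.
Qed.

(** The height changes at most at unit speed, so a connection of length barely above the drop f p -
    f q goes down almost all the time; from a point that is not a fork it can only go down along
    [e]. *)
Lemma desc_edge e p q : ~~ forkp p -> on e p -> f (MPv (bot e)) <= f q -> f q < f p ->
  mg_dist p q <= f p - f q -> on e q.
Proof.
move=> nf ep bq qp d; have [m m0 hm] := finite_pos_bound posM; have [n n0 hn] := access_pos_or_vertex q.
set s := f p - f q in d.
have [k k0 hk] : exists2 k, 0 < k & forall o e' t, arm o e' t p -> k <= t.
  case: (mg_pointP p) => [[v ->]|[e' [t a]]]; first by exists 1; [lra | move=> o e' t [H]].
  have ab := arm_bounds a; exists (Rmin t (glen e' - t)); first by apply: Rmin_pos; lra.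
  move=> o e2 t2 b; have [E ->] := arm_inj a b.
  by case: (true == o); [exact: Rmin_l | exact: Rmin_r].
(* The excess [eta] is below every edge length, every positive access length of [q], and the
   distances from an interior [p] to the ends of its edge. Hence it pays for no detour: neither an
   initial ascent, nor a further edge, nor an entry into one. *)
pose eta := Rmin m (Rmin n k) / 2.
have [em en ek] : [/\ eta < m, eta < n & eta < k].
  rewrite /eta; have := Rmin_l m (Rmin n k); have := Rmin_r m (Rmin n k);
  have := Rmin_l n k; have := Rmin_r n k; have := Rmin_pos _ _ m0 (Rmin_pos _ _ n0 k0).
  by split; lra.
have e0 : 0 < eta.
  by rewrite /eta; have := Rmin_pos _ _ m0 (Rmin_pos _ _ n0 k0); lra.
have : mg_dist p q < s + eta by lra.
case/(conn_of_lt posM connM) => [[x [i l]]|[a [b [w [ha hb W l]]]]].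
  case: (mg_pointP p) => [[v pv]|[e' [t a1]]].
    by move: i; rewrite pv => /direct_vertex [E _]; move: qp; rewrite pv E; lra.
  have [t2 b1 _] := direct_arm a1 i.
  suff -> : e = e' by exact: arm_on b1.
  case: ep => [E|[E|[t3 b3]]]; try by case: a1 => H; rewrite E.
  by case: (arm_inj b3 a1).
have fw := f_walk W; have fb := f_access hb; have b0 := access_ge0 hb.
have w0 := walk_len_ge0 posM w.
have fin : walk_len w + b.2 <= eta -> q = MPv a.1.
  move=> small; have wn : w = nil by apply: NNPP => /(walk_len_ge posM hm); lra.
  by have [|_ ->] := hn _ hb; [lra | move: W; rewrite wn /= => ->].
case: (mg_pointP p) => [[v pv]|[e' [t' a']]]; last first.
  have [t a1] : exists t, arm (low e) e t p.
    by case: ep => [E|[E|//]]; case: a' => H; rewrite E.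
  have fp := f_arm a1; have ft := f_top e; have tb := arm_bounds a1.
  have ka := hk _ _ _ a1; have kb := hk _ _ _ (arm_flip a1).
  case: (access_arm a1 ha) => ea; rewrite ea /= in l fw fin.
    left; apply: fin; rewrite /s in l; lra.
  exfalso; have h2 : Rabs (f (MPv (top e)) - f q) <= walk_len w + b.2.
    move: fw fb; rewrite /top /Rabs; do ?[case: Rcase_abs => ?]; lra.
  move: h2; rewrite ft /Rabs /s in l *; case: Rcase_abs; lra.
subst p; have ea := access_vertex ha; subst a; rewrite /= in l fw fin W.
have vt : v = top e.
  by case: (on_vertex ep) => // E; move: qp bq; rewrite E; lra.
have up o e' t : edge_end o e' = v -> arm o e' t q -> e' = e.
  move=> E /arm_on oq; have op := on_end o e'; rewrite E in op.
  by apply: (top_uniq nf) => //; case: (on_vertex op) => // E2; have := on_bounds oq; rewrite -E2; lra.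
case: w W l fw w0 fin => [|[e1 b1] w] /= W l fw w0 fin.
  case: (mg_pointP q) => [[u qu]|[e' [t a1]]].
    by move: hb; rewrite qu => /access_vertex hb; move: qp; rewrite qu W hb /=; lra.
  case: (access_arm a1 hb) => E; move: W; rewrite E /= => W.
    by rewrite -(up true e' t) //; exact: arm_on a1.
  by rewrite -(up false e' (glen e' - t)) //; [exact: arm_on a1 | exact: (arm_flip a1)].
case: W => W1 W2; have f2 := f_walk W2; have w2 := walk_len_ge0 posM w.
have t1 := f_top e1; have te := f_top e; have me := hm e1.
have fq : Rabs (f (MPv (if b1 then gtgt e1 else gsrc e1)) - f q) <= walk_len w + b.2.
  move: f2 fb; rewrite /Rabs; do ?[case: Rcase_abs => ?]; lra.
have vE : v = edge_end b1 e1 by move: W1; case: (b1) => <-.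
have uE : (if b1 then gtgt e1 else gsrc e1) = edge_end (~~ b1) e1 by case: (b1).
rewrite uE in fq.
have v1 := on_end b1 e1; rewrite -vE in v1; case: (on_vertex v1) => E.
  exfalso; have E2 : edge_end (~~ b1) e1 = top e1 by apply: end_bot; rewrite -vE.
  by move: fq l; rewrite E2 t1 -E /s /Rabs; case: Rcase_abs; lra.
have ee : e1 = e by apply: (top_uniq nf).
subst e1.
have E2 : edge_end (~~ b1) e = bot e by apply: end_top; rewrite -vE.
rewrite E2 in fq.
have small : walk_len w + b.2 <= eta.
  by move: l; rewrite /s; rewrite vt te in qp *; lra.
have wn : w = nil by apply: NNPP => /(walk_len_ge posM hm); lra.
have [|_ ->] := hn _ hb; first lra.
by left; move: W2; rewrite wn /= uE E2 => ->.
Qed.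

(** A point of X below [y] on the way to [r] has the height of [q], and by [Pi_lip] its image is as
    close to [p] as the drop allows. Such an image lies on [e] because [p] is not a fork, and on [e]
    the height determines the point. *)
Lemma strong_lift e p q y : ~~ forkp p -> on e p -> on e q -> f q <= f p -> Pi y = p ->
  exists2 x, Pi x = q & dX y x = f p - f q.
Proof.
move=> nf ep eq [qp|E] py; last first.
  by exists y; [rewrite py; apply: (on_inj ep eq) | rewrite d_refl // E; ring].
have f0 : 0 <= f q by have [x <-] := Pi_surj q; rewrite fPi; exact: d_ge0.
have [|z z1 z2] := @descent X dX mX cX pX r y (f p - f q); first by rewrite -fPi py; lra.
have fz : f (Pi z) = f q by rewrite fPi z1 -fPi py; ring.
exists z => //; apply: (on_inj (e := e)) => //; apply: (desc_edge nf ep); rewrite fz //.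
  by case: (on_bounds eq).
by have := Pi_lip y z; rewrite py z2.
Qed.

(** By compactness, closeness to [p] in the graph implies closeness to its fibre in X: the space is
    covered by the [eta]-neighbourhood of the fibre ([U 0]) and the sets of points whose image is
    farther than 1 / (n + 1) from [p]. *)
Lemma near_fibre p eta : 0 < eta ->
  exists2 c, 0 < c & forall y, mg_dist (Pi y) p < c -> exists2 y', Pi y' = p & dX y y' < eta.
Proof.
move=> e0; pose U n x := if n is n'.+1 then / INR n'.+1 < mg_dist (Pi x) p
  else exists2 y', Pi y' = p & dX x y' < eta.
have [|x|l hl] := cX (U := U).
- case=> [|n]; last first.
    apply: (@metric_open_gt X dX mX (fun x => mg_dist (Pi x) p) 1 (/ INR n.+1)) => x y; apply: Rabs_le.
    have := mg_dist_triangle posM connM (Pi x) (Pi y) p.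
    have := mg_dist_triangle posM connM (Pi y) (Pi x) p.
    by have := Pi_lip x y; rewrite (mg_dist_sym posM connM (Pi y) (Pi x)); lra.
  move=> x [y' y1 y2]; exists (eta - dX x y'); split; first by lra.
  by move=> z l; exists y' => //; have := d_tri mX z x y'; rewrite (d_sym mX z x); lra.
- have [E|ne] := classic (Pi x = p); first by exists 0%N; exists x => //; rewrite d_refl.
  suff [n hn] : exists n, / INR n.+1 < mg_dist (Pi x) p by exists n.+1.
  apply: inv_nat_lt; case: (mg_dist_ge0 posM connM (Pi x) p) => // E; case: ne.
  case: (mg_pointP (Pi x)) => [[v E2]|[e [t a]]].
    have [m m0 hm] := finite_pos_bound posM; rewrite E2 in E *.
    case: (@dist_vertex_star M posM connM m v p hm); [lra | by [] |].
    move=> [o [e [t [ve a]]]]; exfalso; have := f_lip (MPv v) p; rewrite -E -ve.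
    by have := f_end_arm a; have := arm_bounds a; rewrite Rabs_minus_sym => ? ->; lra.
  have ab := arm_bounds a; have := f_lip (Pi x) p.
  have [|s b] := @dist_arm_star M posM connM true e t (Pi x) p a; first by rewrite -E; apply: Rmin_pos; lra.
  by rewrite -E => l; apply: (on_inj (arm_on a) (arm_on b)); move: l; rewrite /Rabs; case: Rcase_abs; lra.
have [c [c0 hc]] := list_inv_bound (map predn l).
exists c => // y ly; have [[|n] [i hn]] := hl y; first by [].
exfalso; have : / INR n.+1 < mg_dist (Pi y) p by [].
by have := hc n; rewrite In_map => /(_ (ex_intro _ n.+1 (conj erefl i))); lra.
Qed.

(** At a fork, a given point of the fibre may have geodesics descending only into another edge. The
    lift therefore starts from a point of [e] slightly below the top, which is no fork, and is then
    moved to a nearby point of the fibre; this end cannot be prescribed. *)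
Lemma weak_lift e q eta : on e q -> f q < f (MPv (top e)) -> 0 < eta ->
  exists x y, [/\ Pi x = q, Pi y = MPv (top e) & dX y x <= f (MPv (top e)) - f q + eta].
Proof.
move=> eq lt e0; have [c c0 hc] := near_fibre (MPv (top e)) e0.
have qb := on_bounds eq; have ft := f_top e.
set T := f (MPv (top e)) in ft lt qb *.
pose h := T - Rmin c (T - f q) / 2.
have m0 : 0 < Rmin c (T - f q) by apply: Rmin_pos; lra.
have m1 := Rmin_l c (T - f q); have m2 := Rmin_r c (T - f q).
have [|p a] := @arm_exists M (low e) e (h - f (MPv (bot e))); first by rewrite /h; lra.
have fp : f p = h by rewrite (f_arm a); ring.
have [y yp] := Pi_surj p.
have nf : ~~ forkp p by case: a => H ->.
have [|x xq d1] := @strong_lift e p q y nf (arm_on a) eq _ yp; first by rewrite fp /h; lra.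
have [|y' y1 y2] := hc y.
  have tope : on e (MPv (top e)) by right; left.
  rewrite yp; have := on_dist (arm_on a) tope; rewrite fp -/T /h /Rabs; case: Rcase_abs; lra.
exists x, y'; split=> //; have := d_tri mX y' y x; rewrite d1 (d_sym mX y' y) fp /h; lra.
Qed.

(** Moving from [v] towards [r] by less than every edge length stays in the star of [v] and loses
    height, hence enters an edge of which [v] is the upper end. *)
Lemma down_edge v : v <> vr -> exists e, top e = v.
Proof.
move=> nv; have [y yv] := Pi_surj (MPv v); have [m m0 hm] := finite_pos_bound posM.
have fy : 0 < dX r y.
  case: (d_ge0 mX r y) => // /esym /(d_eq0 mX) E; move: yv; rewrite -E Pi_root => -[E']; by case: nv.
pose s := Rmin (m / 2) (dX r y).
have [s0 s1 s2] : [/\ 0 < s, s < m & s <= dX r y].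
  rewrite /s; have := Rmin_l (m/2) (dX r y); have := Rmin_r (m/2) (dX r y).
  by have := Rmin_pos (m/2) (dX r y); split; lra.
have [|z z1 z2] := @descent X dX mX cX pX r y s; first by lra.
have fz : f (Pi z) = f (MPv v) - s by rewrite -yv !fPi z1.
have := Pi_lip y z; rewrite yv z2 => l.
case: (@dist_vertex_star M posM connM m v (Pi z) hm); first by lra.
  by move=> E; move: fz; rewrite E; lra.
move=> [o [e [t [ve /arm_on a]]]]; exists e; have := on_end o e; rewrite ve => b.
by case: (on_vertex b) => // E; have := on_bounds a; rewrite -E fz; lra.
Qed.

Lemma top_root e : top e <> vr.
Proof.
move=> E; have := f_top e; have := posM e; rewrite E -Pi_root fPi d_refl //.
have [x <-] := Pi_surj (MPv (bot e)); rewrite fPi; have := d_ge0 mX r x; lra.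
Qed.

(** Edges are counted by their upper ends: none at the root, at least one at any other vertex, at
    least two at a fork. *)
Lemma card_forks : (#|isfork| + #|gV M| <= #|gE M| + 1)%N.
Proof.
have -> : #|gE M| = (\sum_v #|[pred e | top e == v]|)%N.
  rewrite -sum1_card (partition_big top xpredT) //=; apply: eq_bigr => v _.
  by rewrite -sum1_card; apply: eq_bigl => e; rewrite inE.
have -> : #|isfork| = (\sum_v isfork v)%N by rewrite -sum1_card big_mkcond; apply: eq_bigr => v _; rewrite -topredE /=; case: (isfork v).
rewrite -sum1_card (bigD1 vr) //= [X in (_ + X <= _)%N](bigD1 vr) //= [X in (_ <= X + _)%N](bigD1 vr) //=.
have -> : isfork vr = false.
  by apply/negbTE; rewrite /isfork -leqNgt leq_eqVlt ltnS leqn0; apply/orP; right; apply/eqP;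
    apply: eq_card0 => e; rewrite !inE; apply/negbTE/eqP => /top_root.
rewrite add0n addnCA -big_split /= addnC; apply: leq_add => //.
apply: leq_trans (leq_addl _ _); apply: leq_sum => v /eqP nv.
have [e te] := down_edge nv; have : (0 < #|[pred e | top e == v]|)%N.
  by apply/card_gt0P; exists e; rewrite inE te.
by rewrite /isfork; case: (#|_|) => [|[|n]].
Qed.

Lemma forks_le_betti : (Z.of_nat #|isfork| <= betti1 M)%Z.
Proof.
have nc : (0 < ncomp M)%N.
  have sym : connect_sym (adj (M:=M)).
    apply: sym_connect_sym => u v; apply: eq_existsb => e.
    by rewrite orbC.
  rewrite /ncomp /n_comp_mem; apply/card_gt0P; exists (fingraph.root (adj (M:=M)) vr).
  by rewrite !inE /= (roots_root sym).
have := card_forks; rewrite /betti1; move/leP: nc => nc /leP; rewrite /addn; lia.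
Qed.

(** * Lifting paths with free jumps inside fibres *)

Fixpoint jump_len x (l : list (X * X)) y : R :=
  if l is (p, q) :: l' then dX x p + jump_len q l' y else dX x y.

Definition fibre_pairs (l : list (X * X)) := List.Forall (fun pq => Pi pq.1 = Pi pq.2) l.

(** [L] bounds only the legs between jumps; the [n] jumps, being inside fibres, are free here and
    are estimated later. A trivial jump can always be added, so [n] may be increased. *)
Definition reach n L x y := exists l, [/\ size l = n, fibre_pairs l & jump_len x l y <= L].

Lemma reach_move n L L0 x y (z : X) : dX x z <= L0 -> reach n L z y -> reach n (L0 + L) x y.
Proof.
move=> h [l [sl fl jl]]; exists l; split=> //; case: l {sl fl} jl => [|[p q] l] /= jl.
  by have := d_tri mX x z y; lra.
by have := d_tri mX x z p; lra.
Qed.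

Lemma reach_jump n L x y (z : X) : Pi x = Pi z -> reach n L z y -> reach n.+1 L x y.
Proof.
move=> h [l [sl fl jl]]; exists ((x, z) :: l); split; [by rewrite /= sl | by constructor |].
by rewrite /= d_refl //; lra.
Qed.

Lemma reach_le n m L L' x y : (n <= m)%N -> L <= L' -> reach n L x y -> reach m L' x y.
Proof.
move=> nm LL h; rewrite -(subnK nm); elim: (m - n)%N => [|k IH] //.
  by case: h => l [sl fl jl]; exists l; split=> //; lra.
exact: (reach_jump erefl IH).
Qed.

Definition adjacent p q := exists e, on e p /\ on e q.

Fixpoint plen p (l : list (mg_point M)) : R :=
  if l is q :: l' then Rabs (f p - f q) + plen q l' else 0.

Fixpoint pchain p (l : list (mg_point M)) : Prop :=
  if l is q :: l' then adjacent p q /\ pchain q l' else True.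

(** Three consecutive points on one edge could be replaced by two. Excluding them forbids a path
    from turning back on the edge it has just climbed. *)
Fixpoint no_shortcut p (l : list (mg_point M)) : Prop :=
  if l is q :: l' then
    (if l' is z :: _ then ~ (exists e, [/\ on e p, on e q & on e z]) else True) /\ no_shortcut q l'
  else True.

Definition nforks l := count forkp l.

(* By induction along the path, climbing to a fork being the only step that has no exact lift ending at
   a prescribed point: it costs one jump in the fibre of the fork, and descending from it one more. *)
Lemma reach_path l p : pchain p l -> no_shortcut p l ->
  [/\ forall x y eta, 0 < eta -> Pi x = p -> Pi y = last p l ->
        reach (2 * nforks (p :: l) + 1) (plen p l + eta) x y,
      f p <= f (head p l) -> forall y eta, 0 < eta -> Pi y = last p l ->
        exists2 x, Pi x = p & reach (2 * nforks l) (plen p l + eta) x y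
    & forkp p -> f (head p l) < f p -> forall y eta, 0 < eta -> Pi y = last p l ->
        exists2 x, Pi x = p & reach (2 * nforks l + 1) (plen p l + eta) x y].
Proof.
elim: l p => [|q l IH] p /=.
  move=> _ _; have r0 eta x : 0 < eta -> reach 0 (0 + eta) x x.
    by move=> e0; exists nil; split; [by [] | by constructor | by rewrite /= d_refl //; lra].
  split=> [x y eta e0 px py|_ y eta e0 py|_ l]; last by lra.
    by apply: (@reach_le 1 _ (0 + eta)); [lia | lra | apply: (@reach_jump _ _ _ _ y); [rewrite px | apply: r0]].
  by exists y => //; apply: r0.
case=> [[e [ep eq]] ch] [ns1 ns2]; have {IH} [IHP IHQ IHS] := IH q ch ns2.
have [pq|qp] := Rle_lt_dec (f p) (f q).
- have Q y eta : 0 < eta -> Pi y = last q l ->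
      exists2 x, Pi x = p & reach (2 * (forkp q + nforks l)) (Rabs (f p - f q) + plen q l + eta) x y.
    move=> e0 py; have e2 : 0 < eta / 2 by lra.
    have [pqE|pqn] := Req_dec (f p) (f q).
      have E := on_inj ep eq pqE; subst q.
      case: l ch ns1 py {ns2 IHP IHQ IHS} => [|z l] ch ns1 py.
        exists y => //; apply: (@reach_le 0 _ 0); [lia | have := Rabs_pos (f p - f p); rewrite /=; lra |].
        by exists nil; split; [by [] | by constructor | by rewrite /= d_refl //; lra].
      by exfalso; case: ns1; case: ch => -[k [k1 k2]] _; exists k; split.
    have lt : f p < f q by lra.
    have -> : Rabs (f p - f q) = f q - f p by rewrite Rabs_left; lra.
    have [fq|nfq] := boolP (forkp q).
      have [x' px' rx'] : exists2 x', Pi x' = q & reach (2 * nforks l + 1) (plen q l + eta / 2) x' y.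
        have [h|h] := Rle_lt_dec (f q) (f (head q l)); last exact: IHS.
        by have [x' ? rx'] := IHQ h y _ e2 py; exists x' => //; apply: reach_le rx'; [lia | lra].
      have [v qv] : exists v, q = MPv v by move: fq; case: (q) => // v _; exists v.
      have vt : q = MPv (top e).
        by rewrite qv; case: (on_vertex (_ : on e (MPv v))) => [|E|<- //]; rewrite -?qv //;
           have := on_bounds ep; rewrite -E -qv; lra.
      have [|x0 [y0 [px0 py0 d0]]] := weak_lift ep _ e2; first by rewrite -vt.
      exists x0 => //; rewrite -vt in py0 d0.
      apply: (@reach_le (2 * nforks l + 1).+1 _ ((f q - f p + eta / 2) + (plen q l + eta / 2))); [lia | lra |].
      apply: (@reach_move _ _ _ _ _ y0); first by rewrite d_sym.
      by apply: reach_jump rx'; rewrite py0 px'.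
    (* After climbing [e] to a point that is not a fork, the path cannot turn down: the only edge
       downwards is [e], which would be a shortcut. *)
    have asc : f q <= f (head q l).
      apply: Rnot_lt_le; case: l ch ns1 {ns2 IHP IHQ IHS py} => [|z l] /= ch ns1; first lra.
      case: ch => -[k [k1 k2]] _ zq; apply: ns1; exists k.
      by have E := down_uniq nfq eq ep lt k1 k2 zq; subst k; split.
    have [x' px' rx'] := IHQ asc y eta e0 py.
    have [x px dx] := strong_lift nfq eq ep pq px'.
    exists x => //; apply: (@reach_le (2 * nforks l) _ ((f q - f p) + (plen q l + eta))); [lia | lra |].
    by apply: (@reach_move _ _ _ _ _ x') rx'; rewrite d_sym // dx; lra.
  split=> [x y eta e0 px py|_ y eta e0 py|_ l0]; [|exact: Q|by lra].
  have [x' px' rx'] := Q y eta e0 py.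
  apply: (@reach_le (2 * (forkp q + nforks l)).+1 _ _ _ _ _ _ _ (@reach_jump _ _ _ _ x' _ rx'));
    [lia | lra | by rewrite px px'].
have -> : Rabs (f p - f q) = f p - f q by rewrite Rabs_pos_eq; lra.
have S y eta : forkp p -> 0 < eta -> Pi y = last q l ->
    exists2 x, Pi x = p & reach (2 * (forkp q + nforks l) + 1) (f p - f q + plen q l + eta) x y.
  move=> fp e0 py; have e2 : 0 < eta / 2 by lra.
  have [v pv] : exists v, p = MPv v by move: fp; case: (p) => // v _; exists v.
  have vt : p = MPv (top e).
    by rewrite pv; case: (on_vertex (_ : on e (MPv v))) => [|E|<- //]; rewrite -?pv //;
       have := on_bounds eq; rewrite -E -pv; lra.
  have [|x0 [y0 [px0 py0 d0]]] := weak_lift eq _ e2; first by rewrite -vt.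
  rewrite -vt in py0 d0; exists y0 => //.
  apply: (@reach_le (2 * (forkp q + nforks l) + 1) _ ((f p - f q + eta / 2) + (plen q l + eta / 2))); [lia | lra |].
  by apply: (@reach_move _ _ _ _ _ x0) => //; apply: IHP.
split=> [x y eta e0 px py|l0|fp _ y eta e0 py]; [|lra|exact: S].
have [fp|nfp] := boolP (forkp p).
  have [x' px' rx'] := S y eta fp e0 py.
  apply: (@reach_le (2 * (forkp q + nforks l) + 1).+1 _ _ _ _ _ _ _ (@reach_jump _ _ _ _ x' _ rx'));
    [lia | lra | by rewrite px px'].
have [x' px' dx] := strong_lift nfp ep eq (Rlt_le _ _ qp) px.
apply: (@reach_le (2 * (forkp q + nforks l) + 1) _ ((f p - f q) + (plen q l + eta))); [lia | lra |].
by apply: (@reach_move _ _ _ _ _ x'); [lra | apply: IHP].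
Qed.

Lemma pchain_cat p l1 l2 : pchain p l1 -> pchain (last p l1) l2 -> pchain p (l1 ++ l2).
Proof. by elim: l1 p => [|q l1 IH] p //= [h /IH c] /c. Qed.

Lemma plen_cat p l1 l2 : plen p (l1 ++ l2) = plen p l1 + plen (last p l1) l2.
Proof. by elim: l1 p => [|q l1 IH] p /=; [ring | rewrite IH; ring]. Qed.

Lemma walk_path u v w : walk u v w ->
  exists l, [/\ pchain (MPv u) l, last (MPv u) l = MPv v & plen (MPv u) l <= walk_len w].
Proof.
elim: w u => [|[e b] w IH] u /=; first by move=> ->; exists nil; split=> //=; lra.
case=> W1 /IH [l [c E pl]]; exists (MPv (if b then gtgt e else gsrc e) :: l).
have ue : u = edge_end b e by move: W1; case: (b) => <-.
have [o1 o2] : on e (MPv u) /\ on e (MPv (if b then gtgt e else gsrc e)).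
  split; first by rewrite ue; apply: on_end.
  by have := on_end (~~ b) e; case: (b).
split=> //=; first by split=> //; exists e.
have := on_bounds o1; have := on_bounds o2; have := f_top e.
rewrite /Rabs; case: Rcase_abs; lra.
Qed.

Lemma access_adj p a : List.In a (access p) -> p = MPv a.1 \/ adjacent p (MPv a.1).
Proof.
case: (mg_pointP p) => [[v ->] /access_vertex ->|[e [t h]] /(access_arm h) H]; first by left.
right; exists e; split; first exact: arm_on h.
by case: H => -> /=; [exact: (on_end true) | exact: (on_end false)].
Qed.

Lemma path_of_dist p q L : mg_dist p q < L ->
  exists l, [/\ pchain p l, last p l = q & plen p l <= L].
Proof.
case/(conn_of_lt posM connM) => [[x [i l]]|[a [b [w [ha hb /walk_path [k [k1 k2 k3]] l]]]]].
  have [E|[E|[e [t h]]]] : p = q \/ (exists v, p = MPv v) \/ exists e t, arm true e t p.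
    by case: (mg_pointP p); auto.
  - by exists nil; split=> //=; have := direct_ge0 i; lra.
  - by case: E (i) => v -> /direct_vertex [-> _]; exists nil; split=> //=; have := direct_ge0 i; lra.
  have [s b E] := direct_arm h i; exists (q :: nil); split=> //=.
    by split=> //; exists e; split; [exact: arm_on h | exact: arm_on b].
  have := f_edge (on_edge_arm h) (on_edge_arm b); lra.
have fa := f_access ha; have fb := f_access hb.
have [l1 [c1 e1 p1]] : exists l1, [/\ pchain p l1, last p l1 = MPv a.1 & plen p l1 <= a.2].
  case: (access_adj ha) => [E|adj]; first by exists nil; split=> //=; have := access_ge0 ha; lra.
  by exists (MPv a.1 :: nil); split=> //=; lra.
have [l2 [c2 e2 p2]] : exists l2, [/\ pchain (MPv b.1) l2, last (MPv b.1) l2 = q & plen (MPv b.1) l2 <= b.2].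
  case: (access_adj hb) => [E|[e [o1 o2]]]; first by exists nil; split=> //=; have := access_ge0 hb; lra.
  exists (q :: nil); split=> //=; first by split=> //; exists e.
  by rewrite Rabs_minus_sym; lra.
exists (l1 ++ k ++ l2); split.
- by apply: pchain_cat => //; rewrite e1; apply: pchain_cat => //; rewrite k2.
- by rewrite last_cat e1 last_cat k2.
- by rewrite !plen_cat e1 k2; lra.
Qed.

Lemma skip_shortcut p l : pchain p l -> ~ no_shortcut p l ->
  exists l2, [/\ (size l2 < size l)%N, pchain p l2, last p l2 = last p l & plen p l2 <= plen p l].
Proof.
elim: l p => [|q l IH] p //= [pq ch] ns.
have [ns2|/(IH q ch) [l2 [s2 c2 e2 p2]]] := classic (no_shortcut q l); last first.
  by exists (q :: l2); split=> //=; lra.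
case: l ch ns ns2 {IH} => [|z l] /= ch ns ns2; first by case: ns.
have [[e [e1 e2 e3]]|no] := classic (exists e, [/\ on e p, on e q & on e z]); last by case: ns.
exists (z :: l); split=> //=; first by split; [exists e | case: ch].
have := Rabs_triang (f p - f q) (f q - f z).
by rewrite (_ : f p - f q + (f q - f z) = f p - f z); [lra | ring].
Qed.

Definition vert p := if p is MPv v then Some v else None.

Lemma skip_to_vertex p l v : v \in pmap vert l -> pchain p l ->
  exists l2, [/\ (size l2 < size l)%N, pchain (MPv v) l2, last (MPv v) l2 = last p l
    & plen (MPv v) l2 <= plen p l].
Proof.
elim: l p => [|q l IH] p //= h [_ ch].
have [E|nE] := classic (q = MPv v).
  by exists l; rewrite -E; split=> //; have := Rabs_pos (f p - f q); lra.
have /(IH q) [//|l2 [s2 c2 e2 p2]] : v \in pmap vert l.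
  by case: (q) nE h => [u|//] /= nE; rewrite inE => /orP[/eqP E|//]; case: nE; rewrite E.
by exists l2; split=> //; [apply: ltnW | have := Rabs_pos (f p - f q); lra].
Qed.

Lemma skip_loop p l : pchain p l -> ~~ uniq (pmap vert (p :: l)) ->
  exists l2, [/\ (size l2 < size l)%N, pchain p l2, last p l2 = last p l & plen p l2 <= plen p l].
Proof.
elim: l p => [|q l IH] p; first by case: p.
case=> pq ch nu; have [u|/(IH q ch) [l2 [s2 c2 e2 p2]]] := boolP (uniq (pmap vert (q :: l))); last first.
  by exists (q :: l2); split=> //=; lra.
have [v pv vl] : exists2 v, p = MPv v & v \in pmap vert (q :: l).
  by case: (p) nu => [v|e t H]; [rewrite [pmap _ _]/= cons_uniq u andbT negbK; exists v | rewrite [pmap _ _]/= u].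
have [//|l2 h] := @skip_to_vertex p (q :: l) v vl.
by exists l2; rewrite pv in h *.
Qed.

Lemma nforks_le l : uniq (pmap vert l) -> (nforks l <= #|isfork|)%N.
Proof.
move=> u; have -> : nforks l = count isfork (pmap vert l).
  by elim: l {u} => [|[v|e t H] l IH] //=; rewrite /nforks /= -/(nforks l) IH.
rewrite -size_filter -(card_uniqP (filter_uniq isfork u)).
by apply: subset_leq_card; apply/subsetP => v; rewrite mem_filter => /andP[].
Qed.

(** Among nearly shortest paths, deleting middle points and loops shortens the list without
    lengthening the path. The process stops at a path meeting each vertex, hence each fork, at most
    once. *)
Lemma reach_dist x y eta : 0 < eta ->
  reach (2 * #|isfork| + 1) (mg_dist (Pi x) (Pi y) + eta) x y.
Proof.
move=> e0; have e2 : 0 < eta / 2 by lra.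
have [l0 [c0 E0 p0]] := @path_of_dist (Pi x) (Pi y) (mg_dist (Pi x) (Pi y) + eta / 2) ltac:(lra).
have : exists l, [/\ pchain (Pi x) l, last (Pi x) l = Pi y,
    plen (Pi x) l <= mg_dist (Pi x) (Pi y) + eta / 2, no_shortcut (Pi x) l
    & uniq (pmap vert (Pi x :: l))].
  elim: (size l0) {-2}l0 (leqnn (size l0)) c0 E0 p0 => [|n IH] l ls c E pl.
    case: l ls c E pl => // _ _ E pl; exists nil; split=> //=.
    by case: (Pi x).
  have again : (exists l2, [/\ (size l2 < size l)%N, pchain (Pi x) l2, last (Pi x) l2 = last (Pi x) l
      & plen (Pi x) l2 <= plen (Pi x) l]) -> _ := fun '(ex_intro l2 (And4 s2 c2 e2 p2)) =>
      IH l2 (leq_trans s2 ls) c2 (etrans e2 E) (Rle_trans _ _ _ p2 pl).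
  have [ns|ns] := classic (no_shortcut (Pi x) l); last exact: again (skip_shortcut c ns).
  have [u|nu] := boolP (uniq (pmap vert (Pi x :: l))); last exact: again (skip_loop c nu).
  by exists l.
case=> l [c E pl ns u]; have [P _ _] := reach_path c ns.
have := P x y _ e2 erefl (esym E); apply: reach_le; last by lra.
by have := nforks_le u; lia.
Qed.

(** Without forks every descending segment has an exact lift from any prescribed upper point, so
    both points follow the same edges down. The recursion, one edge at a time, is on the number of
    vertices strictly below [Pi p]. *)
Lemma common_descent (p q : X) s : (forall v, ~~ isfork v) -> Pi p = Pi q -> 0 <= s <= dX r p ->
  exists p' q' : X, [/\ dX p p' = s, dX q q' = s, dX r p' = dX r p - s & Pi p' = Pi q'].
Proof.
move=> nofork; have nf z : ~~ forkp z by case: z.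
pose below z := [pred v | if Rlt_dec (f (MPv v)) (f z) then true else false].
have [n] := ubnP #|below (Pi p)|; elim: n p q s => [|n IH] p q s; first by []. move=> /ltnSE ln pq [s0 sr].
have fp := fPi p.
have rq : dX r q = dX r p by rewrite -!fPi pq.
have [E|sn] := Req_dec s 0.
  by exists p, q; split=> //; rewrite ?d_refl //; lra.
have [e ep bp] : exists2 e, on e (Pi p) & f (MPv (bot e)) < f (Pi p).
  case: (mg_pointP (Pi p)) => [[v pv]|[e [t a]]].
    have [|e te] := @down_edge v.
      by move=> E; move: fp; rewrite pv E -Pi_root fPi d_refl //; lra.
    exists e; first by rewrite pv -te; right; left.
    by rewrite pv -te f_top; have := posM e; lra.
  have [t' b] : exists t', arm (low e) e t' (Pi p).
    by case: (arm_on a) => [E|[E|//]]; case: a => H; rewrite E.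
  by exists e; [exact: arm_on a | have := arm_bounds b; rewrite (f_arm b); lra].
have le1 := on_bounds ep.
have [h|h] := Rle_lt_dec (f (MPv (bot e))) (f (Pi p) - s).
  have [|z ez fz] := @on_exists e (f (Pi p) - s); first by lra.
  have zp : f z <= f (Pi p) by lra.
  have [p' pp' dp] := strong_lift (nf _) ep ez zp erefl.
  have [q' qq' dq] := strong_lift (nf _) ep ez zp (esym pq).
  exists p', q'; split; rewrite ?dp ?dq ?pp' ?qq' ?fz //; try lra.
  by rewrite -fPi pp' fz fp.
have ob : on e (MPv (bot e)) by left.
have [p1 pp1 dp] := strong_lift (nf _) ep ob (Rlt_le _ _ bp) erefl.
have [q1 qq1 dq] := strong_lift (nf _) ep ob (Rlt_le _ _ bp) (esym pq).
have fp1 := fPi p1; rewrite pp1 in fp1; have fq1 := fPi q1; rewrite qq1 in fq1.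
have [|||p' [q' [d1 d2 d3 d4]]] := IH p1 q1 (s - (f (Pi p) - f (MPv (bot e)))).
- apply: leq_trans ln; apply: proper_card; rewrite pp1; apply/properP; split.
    by apply/subsetP => v; rewrite !inE; do 2!case: Rlt_dec => //=; lra.
  exists (bot e); rewrite !inE; first by case: Rlt_dec.
  by case: Rlt_dec => // H; exfalso; lra.
- by rewrite pp1.
- by split; lra.
have lev3 : dX r q' = dX r p - s by rewrite -fPi -d4 fPi d3; lra.
have lev2 : dX r p' = dX r p - s by rewrite d3; lra.
have tp := d_tri mX p p1 p'; have tq := d_tri mX q q1 q'.
have up := d_tri mX r p' p; have uq := d_tri mX r q' q.
rewrite (d_sym mX p' p) in up; rewrite (d_sym mX q' q) in uq.
exists p', q'; split=> //; lra.
Qed.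

End ReebMap.

(** * Level sets seen in the approximating graph *)

Section LevelSet.
Variables (X : Type) (dX : X -> X -> R) (r : X).
Hypotheses (mX : is_metric dX) (cX : compact_space dX) (pX : path_metric dX).
Variables (N : fgraph).
Hypothesis fmg : finite_metric_graph N.
Variables (im : X -> mg_point N) (E del eps : R).
Hypotheses (E0 : 0 <= E) (del0 : 0 < del) (Eeps : E + 50 * del <= eps).
Hypothesis im_dist : forall x y, Rabs (dX x y - mg_dist (im x) (im y)) <= 2 * E.

Let posN : mg_positive N. Proof. by case: fmg. Qed.
Let simN : simplicial N. Proof. by case: fmg => _ []. Qed.
Let connN : mg_connected N. Proof. by case: fmg => _ []. Qed.

Implicit Types (x y z : X) (e : gE N) (o : bool) (u v : gV N) (p q : mg_point N).

Notation d := (@mg_dist N).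
Let dsym := mg_dist_sym posN connN.
Let dtri := mg_dist_triangle posN connN.
Let dge0 := mg_dist_ge0 posN connN.
Let drefl := mg_dist_refl posN connN.

(** Images of points at distance at most [h] are at distance at most 2 E + h, strictly less than
    [B]; the strictness provides an actual connection of length [B]. *)
Let B := 2 * E + del.
Let h := del / 2.

Lemma im_le x y c : dX x y <= c -> d (im x) (im y) <= c + 2 * E.
Proof. by move=> l; have := im_dist x y; rewrite /Rabs; case: Rcase_abs; lra. Qed.

Lemma im_ge x y c : d (im x) (im y) <= c -> dX x y <= c + 2 * E.
Proof. by move=> l; have := im_dist x y; rewrite /Rabs; case: Rcase_abs; lra. Qed.

Lemma im_conn x y : dX x y <= h -> conn (im x) (im y) B.
Proof. by move/im_le => l; apply: conn_of_lt => //; rewrite /B /h in l *; lra. Qed.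

Lemma no_loop o e : edge_end o e <> edge_end (~~ o) e.
Proof. by case: simN => nl _; case: o => /= ee; apply: (nl e). Qed.

Lemma edge_uniq o o' e e' : edge_end o e = edge_end o' e' -> edge_end (~~ o) e = edge_end (~~ o') e' -> e = e'.
Proof. by case: simN => _ su; move: o o' => [] [] /= e1 e2; apply: su; auto. Qed.

Lemma end_inj o o' e : edge_end o e = edge_end o' e -> o = o'.
Proof.
case: o o' => [] [] //= E1; [case: (@no_loop true e) | case: (@no_loop false e)]; exact: E1.
Qed.

Definition short e : bool := is_left (Rle_dec (glen e) (8 * eps)).
Definition Sh v : bool := [exists e, short e && ((gsrc e == v) || (gtgt e == v))].

Lemma Sh_end o e : glen e <= 8 * eps -> Sh (edge_end o e).
Proof.
move=> l; apply/existsP; exists e; rewrite /short; case: Rle_dec => [? /=|//].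
by case: o; rewrite /= eqxx ?orbT.
Qed.

Lemma notSh_len o e : ~~ Sh (edge_end o e) -> 8 * eps < glen e.
Proof. by move=> ns; apply: Rnot_le_lt => /(Sh_end o) s; rewrite s in ns. Qed.

Lemma notSh_walk u v l : ~~ Sh u -> walk u v l -> walk_len l <= 8 * eps -> u = v.
Proof.
move=> ns; case: l => [|[e b] l] //= [W _] len.
have uE : u = edge_end b e by move: W; case: (b) => <-.
by rewrite uE in ns; have := notSh_len ns; have := walk_len_ge0 posN l; lra.
Qed.

Lemma notSh_walk_r u v l : ~~ Sh v -> walk u v l -> walk_len l <= 8 * eps -> u = v.
Proof. by move=> ns /(walk_sym) [l' W' <-] len; rewrite (notSh_walk ns W' len). Qed.

Definition Kp u v : bool := is_left (Rle_dec (d (MPv u) (MPv v)) (10 * eps)) && (Sh u || Sh v).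

Lemma KpP u v : d (MPv u) (MPv v) <= 10 * eps -> Sh u || Sh v -> Kp u v.
Proof. by rewrite /Kp; case: Rle_dec. Qed.

(* [on_edge] with positions measured from [edge_end o e]. *)
Definition at_pos o e t p := (t = 0 /\ p = MPv (edge_end o e)) \/
  (t = glen e /\ p = MPv (edge_end (~~ o) e)) \/ arm o e t p.

Lemma dist_at o e t s p q : arm o e t p -> at_pos o e s q -> d p q <= Rabs (t - s).
Proof.
move=> a; have := arm_bounds a => tb; case=> [[-> ->]|[[-> ->]|b]].
- by have := dist_arm posN connN a; rewrite /Rabs; case: Rcase_abs; lra.
- by have := dist_arm posN connN (arm_flip a); rewrite /Rabs; case: Rcase_abs; lra.
exact: dist_arm2 posN connN _ _ _ _ _ _ a b.
Qed.

Lemma dist_pass o e c t s p q P : at_pos o e c P -> arm o e t p -> arm o e s q ->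
  (t <= c <= s \/ s <= c <= t) -> d p P + d P q <= Rabs (t - s).
Proof.
move=> hP a b hc; have := dist_at a hP; have := dist_at b hP; rewrite (dsym P).
by rewrite /Rabs; do ?[case: Rcase_abs => ?]; lra.
Qed.

Lemma dist_end o e c P : 0 <= c <= glen e -> at_pos o e c P -> d P (MPv (edge_end o e)) <= c.
Proof.
move=> hc [[-> ->]|[[-> ->]|b]]; first by rewrite drefl; lra.
  have -> : glen e = walk_len ((e, ~~ o) :: nil) by rewrite /=; ring.
  by apply: dist_walk => //=; case: (o).
exact: dist_arm b.
Qed.

Lemma at_flip o e c P : at_pos o e c P -> at_pos (~~ o) e (glen e - c) P.
Proof.
case=> [[-> ->]|[[-> ->]|b]]; [right; left | left | right; right; exact: arm_flip].
  by rewrite negbK; split=> //; ring.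
by split=> //; ring.
Qed.

(** * Leaving an interval of an edge by descending *)

Definition inI o e lo hi p := exists t, lo < t < hi /\ arm o e t p.
Definition in_edge e p := exists o t, arm o e t p.

Lemma inI_edge o e lo hi p : inI o e lo hi p -> in_edge e p.
Proof. by case=> t [_ a]; exists o, t. Qed.

Lemma in_edge_pos o e p : in_edge e p -> exists t, arm o e t p.
Proof.
case=> o' [t a]; case: (boolP (o == o')) => [/eqP ->|ne]; first by exists t.
exists (glen e - t); have -> : o = ~~ o' by case: (o) (o') ne => [] [].
exact: arm_flip.
Qed.

(** A connection leaving the interval either moves along [e] past [lo] or [hi], or goes through an
    end of [e]; in both cases it passes one of [P1], [P2], so its length splits there. *)
Lemma exit_step o e lo hi P1 P2 t p q : 0 <= lo -> hi <= glen e -> at_pos o e lo P1 -> at_pos o e hi P2 ->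
  arm o e t p -> lo < t < hi -> conn p q B -> ~ inI o e lo hi q ->
  d p P1 + d P1 q <= B \/ d p P2 + d P2 q <= B.
Proof.
move=> lo0 hi1 h1 h2 a tI cn nI; have tb := arm_bounds a.
case: cn => [[x [i l]]|[b [c [w [hb hc W l]]]]].
  have [s as_ xE] := direct_arm a i; rewrite xE in l.
  have [sl|sl] := Rle_lt_dec s lo.
    by left; apply: Rle_trans l; apply: dist_pass h1 a as_ _; right; lra.
  have [sh|sh] := Rle_lt_dec hi s.
    by right; apply: Rle_trans l; apply: dist_pass h2 a as_ _; left; lra.
  by case: nI; exists s.
have wq : d (MPv b.1) q <= walk_len w + c.2.
  have := dtri (MPv b.1) (MPv c.1) q; have := dist_walk posN connN W.
  by have := dist_access posN connN hc; rewrite (dsym q); lra.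
have lob : 0 <= lo <= glen e by lra.
have hib : 0 <= glen e - hi <= glen e by lra.
case: (access_arm a hb) => bE; rewrite bE /= in wq l.
  left; have := dist_at a h1; have := dist_end lob h1; have := dtri P1 (MPv (edge_end o e)) q.
  by rewrite /Rabs; case: Rcase_abs; lra.
right; have := dist_at a h2; have := dist_end hib (at_flip h2).
have := dtri P2 (MPv (edge_end (~~ o) e)) q.
by rewrite /Rabs; case: Rcase_abs; lra.
Qed.

Variable a : R.
Hypothesis deep : 3 * E + 3 * del < a.
Definition lev x := dX r x = a.

(* [z] lies at most [3 E + del] below the level [a] under [x], and the image of a path from [x]
   through [z] leaves the interval through [P] when passing from [z] to [z']. *)
Definition exits (I : mg_point N -> Prop) P x := exists z z', [/\ dX x z <= a - dX r z,
  a - dX r z <= 3 * E + del, dX z z' <= h, d (im z) P + d P (im z') <= B & ~ I (im z')].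

(** A descending point whose image is still in the interval is within E + del in the image, hence
    within 3 E + del in X, of a point of the level; this bounds its depth. A longer descent has to
    leave. *)
Lemma descend_exits o e lo hi P1 P2 x : 0 <= lo -> hi <= glen e -> at_pos o e lo P1 -> at_pos o e hi P2 ->
  (forall w, inI o e lo hi w -> exists2 y, lev y & d (im y) w <= E + del) ->
  lev x -> inI o e lo hi (im x) -> exits (inI o e lo hi) P1 x \/ exits (inI o e lo hi) P2 x.
Proof.
move=> lo0 hi1 h1 h2 cov lx Ix; apply: NNPP => no.
have h0 : 0 < h by rewrite /h; lra.
have shallow z : inI o e lo hi (im z) -> a - dX r z <= 3 * E + del.
  case/cov => y ly /im_ge l; have := d_tri mX r z y; rewrite ly (d_sym mX z y); lra.
have down n : INR n * h <= a -> exists z, [/\ dX r z = a - INR n * h, dX x z <= INR n * h & inI o e lo hi (im z)].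
  elim: n => [|n IH]; first by exists x; rewrite /= d_refl //; split=> //; rewrite ?lx; lra.
  rewrite S_INR => l; have [|z [z1 z2 z3]] := IH; first by lra.
  have [|z' z'1 z'2] := @descent X dX mX cX pX r z h; first by rewrite z1; lra.
  exists z'; split; [by rewrite z'1 z1; ring | by have := d_tri mX x z z'; lra |].
  apply: NNPP => nI; apply: no.
  have sz := shallow _ z3; case: (z3) => t [tI at_].
  case: (exit_step lo0 hi1 h1 h2 at_ tI (@im_conn z z' _) nI); first by lra.
    by move=> l1; left; exists z, z'; split=> //; lra.
  by move=> l1; right; exists z, z'; split=> //; lra.
(* The first multiple of [h] beyond 3 E + del; by [deep] the descent by that much does not pass
   below [r]. *)
have [k [k1 k2]] : exists k, 3 * E + del < INR k * h /\ INR k * h <= a.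
  have [k1 k2] := archimed ((3 * E + del) / h).
  have pos : 0 < (3 * E + del) / h by apply: Rdiv_lt_0_compat; lra.
  exists (Z.to_nat (up ((3 * E + del) / h))).
  rewrite INR_IZR_INZ Z2Nat.id; last by apply: le_IZR; lra.
  have hE : (3 * E + del) / h * h = 3 * E + del by field; lra.
  by split; rewrite /h in h0 k1 k2 hE *; nra.
by have [z [z1 z2 z3]] := down k k2; have := shallow z z3; lra.
Qed.

(** Consecutive images are compared by their positions on [e], not by their distance in the graph,
    which could be realized around the edge; only so does the chain nearly cover what it crosses. *)
Inductive seg o e : X -> X -> Prop :=
| seg_one x t : lev x -> arm o e t (im x) -> seg o e x x
| seg_cons x y z t s : lev x -> arm o e t (im x) -> arm o e s (im y) -> dX x y <= h ->
    Rabs (t - s) <= B -> seg o e y z -> seg o e x z.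

Lemma seg_head o e x y : seg o e x y -> lev x /\ exists t, arm o e t (im x).
Proof. by case=> [{}x t l a1|{}x {}y z t s l a1 _ _ _ _]; split=> //; exists t. Qed.

Lemma seg_rcons o e x y z t s : seg o e x y -> lev z -> arm o e t (im y) -> arm o e s (im z) ->
  dX y z <= h -> Rabs (t - s) <= B -> seg o e x z.
Proof.
elim=> [{}x t1 l a1 lz a2 a3 dl tl | x1 x2 x3 t1 s1 l a1 b1 d1 l1 _ IH lz a2 a3 dl tl].
  by apply: (seg_cons l a2 a3 dl tl); apply: (seg_one lz a3).
exact: seg_cons l a1 b1 d1 l1 (IH lz a2 a3 dl tl).
Qed.

Lemma seg_rev o e x y : seg o e x y -> seg o e y x.
Proof.
elim=> [{}x t l a1 | x1 x2 x3 t s l a1 b1 d1 l1 _ IH]; first exact: seg_one l a1.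
apply: seg_rcons IH l b1 a1 _ _; first by rewrite d_sym.
by rewrite Rabs_minus_sym.
Qed.

Lemma seg_last o e x y : seg o e x y -> lev y /\ exists t, arm o e t (im y).
Proof. by move/seg_rev/seg_head. Qed.

Lemma seg_flip o e x y : seg o e x y -> seg (~~ o) e x y.
Proof.
elim=> [{}x t l a1 | x1 x2 x3 t s l a1 b1 d1 l1 _ IH]; first exact: seg_one l (arm_flip a1).
apply: seg_cons l (arm_flip a1) (arm_flip b1) d1 _ IH.
by rewrite (_ : _ - _ = s - t); [rewrite Rabs_minus_sym | ring].
Qed.

Lemma seg_cover o e x y t s c : seg o e x y -> arm o e t (im x) -> arm o e s (im y) ->
  (t <= c <= s \/ s <= c <= t) -> exists z t', [/\ lev z, arm o e t' (im z) & Rabs (t' - c) <= B / 2].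
Proof.
have B0 : 0 < B by rewrite /B; lra.
move=> sg; elim: sg t => [{}x t1 l a1 t a2 a3 hc | x1 x2 x3 t1 s1 l a1 b1 d1 l1 sg IH t a2 a3 hc].
  by exists x, t; split=> //; have := arm_same a2 a3; rewrite /Rabs; case: Rcase_abs; lra.
have E1 := arm_same a2 a1; subst t1.
have [hc2|hc2] := classic (s1 <= c <= s \/ s <= c <= s1); first exact: IH b1 a3 hc2.
have [l2|l2] := Rle_lt_dec (Rabs (t - c)) (B / 2); first by exists x1, t.
exists x2, s1; split=> //; first by case: (seg_head sg).
move: l1 l2; rewrite /Rabs; do ?[case: Rcase_abs => ?]; lra.
Qed.

Lemma exits_here (I : mg_point N -> Prop) P x z' : lev x -> dX x z' <= h -> d (im x) P + d P (im z') <= B ->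
  ~ I (im z') -> exits I P x.
Proof. by move=> lx l1 l2 nI; exists x, z'; split=> //; rewrite ?d_refl // lx; lra. Qed.

(* The set left through [P1] and the set left through [P2] cover the chain and each contains one of its
   ends, so two consecutive points are of different kinds. *)
Lemma exits_both o e lo hi P1 P2 x0 y0 : 0 <= lo -> lo < hi -> hi <= glen e ->
  at_pos o e lo P1 -> at_pos o e hi P2 ->
  (forall w, inI o e lo hi w -> exists2 y, lev y & d (im y) w <= E + del) ->
  seg o e x0 y0 ->
  (exists t, arm o e t (im x0) /\ (t <= lo \/ exists z, [/\ lo <= t, dX x0 z <= h,
     t - lo + d P1 (im z) <= B & ~ inI o e lo hi (im z)])) ->
  (exists t, arm o e t (im y0) /\ (hi <= t \/ exists z, [/\ t <= hi, dX y0 z <= h,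
     hi - t + d P2 (im z) <= B & ~ inI o e lo hi (im z)])) ->
  exists x1 x2, [/\ exits (inI o e lo hi) P1 x1, exits (inI o e lo hi) P2 x2 & dX x1 x2 <= h].
Proof.
move=> lo0 lohi hi1 h1 h2 cov sg left right.
set I := inI o e lo hi.
have h0 : 0 < h by rewrite /h; lra.
have nI_lo t w : arm o e t w -> t <= lo -> ~ I w.
  by move=> a1 l [s [sI a2]]; have := arm_same a1 a2; lra.
have nI_hi t w : arm o e t w -> hi <= t -> ~ I w.
  by move=> a1 l [s [sI a2]]; have := arm_same a1 a2; lra.
have dP : d P1 P2 <= hi - lo.
  have le2 : 0 <= hi <= glen e by lra.
  case: h1 => [[e1 ->]|[[e1 ->]|a1]]; [|lra|].
    by have := dist_end le2 h2; rewrite dsym; lra.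
  by have := dist_at a1 h2; rewrite /Rabs; case: Rcase_abs; lra.
apply: NNPP => no.
pose A x := exists t, arm o e t (im x) /\ ((t < hi /\ exits I P1 x) \/ t <= lo).
pose A' x := exists t, arm o e t (im x) /\ ((lo < t /\ exits I P2 x) \/ hi <= t).
have AA x : lev x -> (exists t, arm o e t (im x)) -> A x \/ A' x.
  move=> lx [t a1]; have [l1|l1] := Rle_lt_dec t lo; first by left; exists t; auto.
  have [l2|l2] := Rle_lt_dec hi t; first by right; exists t; auto.
  case: (descend_exits lo0 hi1 h1 h2 cov lx); first by exists t.
    by left; exists t; auto.
  by right; exists t; auto.
have A0 : A x0.
  case: left => t [a1 [l1|[z [l0 l1 l2 l3]]]]; first by exists t; auto.
  have [lx _] := seg_head sg.
  have ex : exits I P1 x0.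
    by apply: (exits_here lx l1 _ l3); have := dist_at a1 h1; rewrite /Rabs; case: Rcase_abs; lra.
  exists t; split=> //; left; split=> //; apply: Rnot_le_lt => l4; apply: no; exists x0, x0.
  split=> //; last by rewrite d_refl //; lra.
  apply: (exits_here lx l1 _ l3).
  have := dist_at a1 h2; have := dtri P2 P1 (im z); rewrite (dsym P2 P1) /Rabs; case: Rcase_abs; lra.
have A'0 : A' y0.
  case: right => t [a1 [l1|[z [l0 l1 l2 l3]]]]; first by exists t; auto.
  have [ly _] := seg_last sg.
  have ex : exits I P2 y0.
    by apply: (exits_here ly l1 _ l3); have := dist_at a1 h2; rewrite /Rabs; case: Rcase_abs; lra.
  exists t; split=> //; left; split=> //; apply: Rnot_le_lt => l4; apply: no; exists y0, y0.
  split=> //; last by rewrite d_refl //; lra.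
  apply: (exits_here ly l1 _ l3).
  have := dist_at a1 h1; have := dtri P1 P2 (im z); rewrite /Rabs; case: Rcase_abs; lra.
have pair x y t s : lev x -> lev y -> arm o e t (im x) -> arm o e s (im y) -> dX x y <= h ->
    Rabs (t - s) <= B -> A x -> A' y -> False.
  move=> lx ly a1 a2 dl tl [t' [a1' Ax]] [s' [a2' Ay]].
  have tE := arm_same a1' a1; have sE := arm_same a2' a2; subst t' s'; apply: no.
  have dl' : dX y x <= h by rewrite d_sym.
  case: Ax => [[l1 ex]|l1]; case: Ay => [[l2 ey]|l2].
  - by exists x, y.
  - exists x, x; split=> //; last by rewrite d_refl //; lra.
    apply: (exits_here lx dl _ (nI_hi _ _ a2 l2)); apply: Rle_trans tl.
    by apply: dist_pass h2 a1 a2 _; left; lra.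
  - exists y, y; split=> //; last by rewrite d_refl //; lra.
    apply: (exits_here ly dl' _ (nI_lo _ _ a1 l1)).
    apply: Rle_trans tl; rewrite Rabs_minus_sym; apply: dist_pass h1 a2 a1 _; right; lra.
  - exists x, x; split; last by rewrite d_refl //; lra.
      apply: (exits_here lx dl _ (nI_hi _ _ a2 l2)); apply: Rle_trans tl.
      by apply: dist_pass h1 a1 a2 _; left; lra.
    apply: (exits_here lx dl _ (nI_hi _ _ a2 l2)); apply: Rle_trans tl.
    by apply: dist_pass h2 a1 a2 _; left; lra.
elim: sg A0 A'0 {left right} => [{}x0 t l a1 A0 A'0 | x1 x2 x3 t s l a1 b1 d1 l1 sg IH A0 A'0].
  by apply: (pair x0 x0 t t) => //; [rewrite d_refl //; lra | rewrite Rminus_diag Rabs_R0 /B; lra].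
have [l2 ex2] := seg_head sg.
by case: (AA x2 l2 ex2) => [Ax2|A'x2]; [exact: IH | exact: (pair x1 x2 t s)].
Qed.

(** One of the two points around an exit has its image within B / 2 of the exit point. Choosing the
    nearer one, rather than paying [B] twice, keeps the total at 10 E + 9 / 2 del. *)
Lemma exits_dist I1 I2 P1 P2 x1 x2 : exits I1 P1 x1 -> exits I2 P2 x2 -> dX x1 x2 <= h -> d P1 P2 <= 10 * eps.
Proof.
move=> [z1 [z1' [l1 l2 l3 l4 _]]] [z2 [z2' [k1 k2 k3 k4 _]]] l.
have [w1 [m1 m2]] : exists w1 : X, dX x1 w1 <= 3 * E + del + h /\ d P1 (im w1) <= B / 2.
  have [c|c] := Rle_lt_dec (d (im z1) P1) (B / 2); first by exists z1; rewrite dsym; split=> //; rewrite /h; lra.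
  by exists z1'; split; [have := d_tri mX x1 z1 z1'; lra | lra].
have [w2 [n1 n2]] : exists w2 : X, dX x2 w2 <= 3 * E + del + h /\ d P2 (im w2) <= B / 2.
  have [c|c] := Rle_lt_dec (d (im z2) P2) (B / 2); first by exists z2; rewrite dsym; split=> //; rewrite /h; lra.
  by exists z2'; split; [have := d_tri mX x2 z2 z2'; lra | lra].
have lw : dX w1 w2 <= 6 * E + 2 * del + 3 * h.
  have := d_tri mX w1 x1 w2; have := d_tri mX x1 x2 w2; rewrite (d_sym mX w1 x1); lra.
have := im_le lw; have := dtri P1 (im w1) P2; have := dtri (im w1) (im w2) P2.
rewrite (dsym (im w2)) /B /h in m2 n2 *; lra.
Qed.

(** A vertex off the short edges has only edges longer than 8 eps, so the [B]-ball around it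
    contains no second vertex. *)
Lemma star_of V q : ~~ Sh V -> d (MPv V) q <= B ->
  q = MPv V \/ exists o e t, [/\ edge_end o e = V, arm o e t q & t <= B + del].
Proof.
move=> ns l; have : d (MPv V) q < B + del by lra.
case/(conn_of_lt posN connN) => [[x [/direct_vertex [-> _] _]]|[b [c [w [/access_vertex -> hc W l2]]]]].
  by left.
have c0 := access_ge0 hc; have w0 := walk_len_ge0 posN w; rewrite /= in W l2.
have V2 : V = c.1 by apply: (notSh_walk ns W); rewrite /B in l2 *; lra.
case: (mg_pointP q) => [[u qu]|[e [t a1]]].
  by left; move: hc; rewrite qu => /access_vertex hc; rewrite V2 hc.
right; case: (access_arm a1 hc) => cE; rewrite cE /= in V2 l2 c0.
  by exists true, e, t; split=> //; lra.
by exists false, e, (glen e - t); split=> //; [exact: (arm_flip a1) | lra].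
Qed.

Lemma star_access V q c : (q = MPv V \/ exists o e t, [/\ edge_end o e = V, arm o e t q & t <= B + del]) ->
  List.In c (access q) -> c.1 = V \/
  exists o e, [/\ edge_end o e = V, c.1 = edge_end (~~ o) e, glen e - (B + del) <= c.2 & in_edge e q].
Proof.
case=> [-> /access_vertex -> |[o [e [t [eV a1 tl]]]] /(access_arm a1) [->|->]] /=; try by left.
by right; exists o, e; split=> //; [lra | exists o, t].
Qed.

(** Such a connection contains no full edge, every walk of length at most 8 eps from either end
    being empty. It would thus need a second edge with the same ends as [e], excluded in a
    simplicial complex, or most of two edges longer than 8 eps. *)
Lemma no_link o e p q : ~~ Sh (edge_end o e) -> ~~ Sh (edge_end (~~ o) e) ->
  d (MPv (edge_end o e)) p <= B -> d (MPv (edge_end (~~ o) e)) q <= B ->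
  ~ in_edge e p -> ~ in_edge e q -> d p q < 8 * eps -> False.
Proof.
move=> n1 n2 /(star_of n1) sp /(star_of n2) sq ep eq.
have V12 := @no_loop o e.
case/(conn_of_lt posN connN) => [[x [i _]]|[b [c [w [hb hc W l]]]]].
  case: sp => [E1|[o1 [e1 [t1 [eV1 a1 _]]]]].
    move: i; rewrite E1 => /direct_vertex [E2 _]; case: sq => [E3|[o2 [e2 [t2 [_ [H E3]  _]]]]].
      by move: E3; rewrite E2 => -[].
    by rewrite E3 in E2.
  have [s b1 _] := direct_arm a1 i.
  case: sq => [E3|[o2 [e2 [t2 [eV2 a2 _]]]]]; first by case: b1 => H; rewrite E3.
  have [E3 _] := arm_inj b1 a2; subst e2.
  have oo : o2 = ~~ o1.
    by case: (o1) (o2) eV1 eV2 => [] [] //= -> E4; case: V12.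
  subst o2; have E4 : e = e1 by apply: (@edge_uniq o o1).
  by subst e1; apply: ep; exists o1, t1.
have b0 := access_ge0 hb; have c0 := access_ge0 hc; have w0 := walk_len_ge0 posN w.
have lw : walk_len w <= 8 * eps by lra.
case: (star_access sp hb) => [E1|[o1 [e1 [eV1 E1 l1 p1]]]]; case: (star_access sq hc) => [E2|[o2 [e2 [eV2 E2 l2 q2]]]];
  rewrite E1 E2 in W.
- exact: V12 (notSh_walk n1 W lw).
- have E3 := notSh_walk n1 W lw; apply: eq; have -> // : e = e2.
  by apply: (@edge_uniq o (~~ o2)); rewrite ?negbK.
- have E3 := notSh_walk_r n2 W lw; apply: ep; have -> // : e = e1.
  by apply: (@edge_uniq o o1).
have g1 : 8 * eps < glen e1 by apply: (@notSh_len o1); rewrite eV1.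
have g2 : 8 * eps < glen e2 by apply: (@notSh_len o2); rewrite eV2.
rewrite /B in l1 l2; lra.
Qed.

(* The image jumps from [x] on [e] to [z] through the end [edge_end o e]. In the second case [z] is
   again on [e], its image being reached by a walk around [e]. *)
Definition Entry o e x := exists t z, [/\ lev z, dX x z <= h, arm o e t (im x),
  t + d (MPv (edge_end o e)) (im z) <= B &
  ~ in_edge e (im z) \/ exists s w, [/\ arm o e s (im z), walk (edge_end o e) (edge_end (~~ o) e) w
    & t + walk_len w + (glen e - s) <= B]].

(** Between the end of entry and [x], positions near [x] are covered by [x]; the others are reached
    from [z] through the end, since the jump used at most [B]. *)
Lemma half_cover o e t c x z q : arm o e t (im x) -> t + d (MPv (edge_end o e)) (im z) <= B ->
  lev x -> lev z -> c <= t -> arm o e c q -> exists2 y, lev y & d (im y) q <= E + del.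
Proof.
move=> a1 l lx lz ct a2; have [l2|l2] := Rle_lt_dec (t - c) (E + del).
  exists x => //; have := dist_arm2 posN connN a1 a2; rewrite /Rabs; case: Rcase_abs; lra.
exists z => //; have := dtri (im z) (MPv (edge_end o e)) q; have := dist_arm posN connN a2.
rewrite (dsym q (MPv _)) (dsym (im z) (MPv _)) /B in l *; lra.
Qed.

Lemma loop_Kp o e w : walk (edge_end o e) (edge_end (~~ o) e) w -> walk_len w <= B ->
  Kp (edge_end o e) (edge_end (~~ o) e).
Proof.
move=> W l; apply: KpP; first by have := dist_walk posN connN W; rewrite /B in l; lra.
apply/orP; left; apply: contraT => ns; case: (@no_loop o e); apply: (notSh_walk ns W).
by rewrite /B in l; lra.
Qed.

Lemma Kp_sym u v : Kp u v = Kp v u.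
Proof. by rewrite /Kp (dsym (MPv u)) orbC. Qed.

(** The chain covers the positions between [x] and [y], the two jumps through the ends cover the
    rest, so the whole open edge serves as the interval. A jump returning to [e] around it gives a
    link directly. *)
Lemma traverse o e x y : Entry o e x -> Entry (~~ o) e y -> seg o e x y ->
  Kp (edge_end o e) (edge_end (~~ o) e).
Proof.
move=> [t [z [lz dz a1 l1 alt1]]] [s [z' [lz' dz' b1 l2 alt2]]] sg.
have [lx _] := seg_head sg; have [ly _] := seg_last sg.
have tb := arm_bounds a1; have sb := arm_bounds b1.
case: alt1 => [n1|[s' [w [a' W l]]]]; last first.
  by apply: (loop_Kp W); have := arm_bounds a'; lra.
case: alt2 => [n2|[s' [w [a' W l]]]]; last first.
  rewrite Kp_sym -{2}(negbK o); apply: (loop_Kp W); have := arm_bounds a'; lra.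
have b2 := arm_flip b1; rewrite negbK in b2.
have g0 := posN e.
have P1 : at_pos o e 0 (MPv (edge_end o e)) by left.
have P2 : at_pos o e (glen e) (MPv (edge_end (~~ o) e)) by right; left.
have cov q : inI o e 0 (glen e) q -> exists2 y, lev y & d (im y) q <= E + del.
  case=> c [hc a2]; have [l3|l3] := Rle_lt_dec c t; first exact: half_cover a1 l1 lx lz l3 a2.
  have [l4|l4] := Rle_lt_dec (glen e - c) s; first exact: half_cover b1 l2 ly lz' l4 (arm_flip a2).
  have [|k [t' [lk ak kl]]] := @seg_cover o e x y t (glen e - s) c sg a1 b2; first by left; lra.
  exists k => //; have := dist_arm2 posN connN ak a2; rewrite /B in kl; lra.
have [||x1 [x2 [e1 e2 dl]]] := exits_both (Rle_refl 0) g0 (Rle_refl _) P1 P2 cov sg.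
- exists t; split=> //; right; exists z; split=> //; try lra.
  by move/inI_edge.
- exists (glen e - s); split=> //; right; exists z'; split=> //; try lra.
  by move/inI_edge.
apply: KpP; first exact: exits_dist e1 e2 dl.
(* Just after their exits the two descending points have images less than 8 eps apart and off [e],
   near its two ends; if neither end lay on a short edge, [no_link] would apply. *)
apply: contraT; rewrite negb_or => /andP[ns1 ns2]; exfalso.
case: e1 => z1 [z1' [k1 k2 k3 k4 k5]]; case: e2 => z2 [z2' [m1 m2 m3 m4 m5]].
have ie q : in_edge e q -> inI o e 0 (glen e) q.
  by move/(in_edge_pos o) => [c a2]; exists c; split=> //; exact: arm_bounds a2.
apply: (no_link (p := im z1') (q := im z2') ns1 ns2).
- by have := dge0 (im z1) (MPv (edge_end o e)); lra.
- by have := dge0 (im z2) (MPv (edge_end (~~ o) e)); lra.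
- by move/ie.
- by move/ie.
have dd : dX z1' z2' <= 6 * E + 2 * del + 3 * h.
  have := d_tri mX z1' z1 z2'; have := d_tri mX z1 x1 z2'; have := d_tri mX x1 x2 z2'; have := d_tri mX x2 z2 z2'.
  rewrite (d_sym mX z1' z1) (d_sym mX z1 x1); lra.
have := im_le dd; rewrite /h; lra.
Qed.

(** The sharper bound 7 eps in the absence of short edges is what makes fibres have diameter at most
    7 + 7 + 2 = 16 eps in that case. *)
Definition attached x u := d (im x) (MPv u) <= 10 * eps /\ ((forall v, ~~ Sh v) -> d (im x) (MPv u) <= 7 * eps).

Lemma attached_self x u : im x = MPv u -> attached x u.
Proof. by rewrite /attached => ->; rewrite drefl; split; lra. Qed.

(** The interval is the part of [e] from the end of entry to [y], both of whose bounding points are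
    exits; [exits_dist] then gives 10 eps. *)
Lemma attach o e x y : Entry o e x -> seg o e x y -> attached y (edge_end o e).
Proof.
move=> [t [z [lz dz a1 l1 alt1]]] sg.
have [lx _] := seg_head sg; have [ly [c b1]] := seg_last sg.
have tb := arm_bounds a1; have cb := arm_bounds b1.
have triv : c <= B + del -> attached y (edge_end o e).
  by move=> cl; have := dist_arm posN connN b1; rewrite /B in cl; split; lra.
have [nI|close] : ~ inI o e 0 c (im z) \/ attached y (edge_end o e); last by [].
  case: alt1 => [n1|[s [w [a2 W l]]]]; first by left; move/inI_edge.
  have [cs|sc] := Rle_lt_dec c s; first by left; case=> s' [sI a3]; have := arm_same a2 a3; lra.
  right; have := dist_walk posN connN W; have := dist_arm posN connN (arm_flip b1).
  have := dtri (im y) (MPv (edge_end (~~ o) e)) (MPv (edge_end o e)).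
  by rewrite (dsym (MPv (edge_end (~~ o) e))) /B in l *; split; lra.
have P1 : at_pos o e 0 (MPv (edge_end o e)) by left.
have P2 : at_pos o e c (im y) by right; right.
have cov q : inI o e 0 c q -> exists2 y, lev y & d (im y) q <= E + del.
  case=> k [hk a2]; have [l3|l3] := Rle_lt_dec k t; first exact: half_cover a1 l1 lx lz l3 a2.
  have [|k' [t' [lk ak kl]]] := @seg_cover o e x y t c k sg a1 b1; first by left; lra.
  exists k' => //; have := dist_arm2 posN connN ak a2; rewrite /B in kl; lra.
have [||||x1 [x2 [e1 e2 dl]]] := exits_both (Rle_refl 0) _ _ P1 P2 cov sg; try lra.
- exists t; split=> //; right; exists z; split=> //; lra.
- by exists c; split=> //; left; lra.
split; first by rewrite dsym; exact: exits_dist e1 e2 dl.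
move=> noSh; apply: Rnot_lt_le => far.
have c7 : 7 * eps < c by have := dist_arm posN connN b1; lra.
have trivwalk u v w : walk u v w -> walk_len w <= 8 * eps -> u = v := notSh_walk (noSh u).
have V12 := @no_loop o e.
case: e1 => z1 [z1' [k1 k2 k3 k4 k5]]; case: e2 => z2 [z2' [m1 m2 m3 m4 m5]].
have d1 : d (MPv (edge_end o e)) (im z1') <= B by have := dge0 (im z1) (MPv (edge_end o e)); lra.
have d2 : d (im y) (im z2') <= B by have := dge0 (im z2) (im y); lra.
have s1 := star_of (noSh _) d1.
have ne1 : ~ in_edge e (im z1').
  move=> /(in_edge_pos o) [t1 a2]; apply: k5; exists t1; split=> //; split; first by have := arm_bounds a2; lra.
  case: s1 => [E1|[o1 [e1 [t2 [eV a3 tl]]]]]; first by case: a2 => H; rewrite E1.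
  have [E1 _] := arm_inj a2 a3; subst e1; have E2 := end_inj eV; subst o1.
  by rewrite (arm_same a2 a3); rewrite /B in tl; lra.
have lz2 : dX y z2' <= d (im y) (im z2') + 2 * E by apply: im_ge; lra.
(* A second bound on the depth at which the image passes [im y]: it grows with the distance
   travelled beyond [im y], so that this distance cancels in the estimate of [c]. *)
have dep : a - dX r z2 <= d (im y) (im z2') + 2 * E + h.
  have := d_tri mX r z2 y; have := d_tri mX y z2' z2; rewrite ly (d_sym mX z2 y) (d_sym mX z2' z2); lra.
have dd : dX z1' z2' <= (3 * E + del) + (a - dX r z2) + 3 * h.
  have := d_tri mX z1' z1 z2'; have := d_tri mX z1 x1 z2'; have := d_tri mX x1 x2 z2'; have := d_tri mX x2 z2 z2'.
  rewrite (d_sym mX z1' z1) (d_sym mX z1 x1); lra.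
have ff := im_le dd.
have ff8 : d (im z1') (im z2') < 8 * eps by rewrite /h in ff *; lra.
have [[s [sc a2]]|[w2 ne2]] : (exists s, c <= s /\ arm o e s (im z2')) \/
    (d (MPv (edge_end (~~ o) e)) (im z2') <= B /\ ~ in_edge e (im z2')).
- have [ie|nie] := classic (in_edge e (im z2')).
    have [s a2] := in_edge_pos o ie; left; exists s; split=> //; apply: Rnot_lt_le => sc.
    by apply: m5; exists s; split=> //; have := arm_bounds a2; lra.
  (* The excess [k] is absorbed by the rest glen e - c of the edge, so the far end is within exactly
     [B] of [im z2']. *)
  right; split=> //; pose k := Rmin del (glen e - c).
  have [kd kc] : k <= del /\ k <= glen e - c by split; [exact: Rmin_l | exact: Rmin_r].
  have k0 : 0 < k by apply: Rmin_pos; lra.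
  have : d (im y) (im z2') < d (im y) (im z2') + k by lra.
  case/(conn_of_lt posN connN) => [[x3 [i _]]|[b [b' [w [hb hb' W l]]]]].
    by case: nie; have [s a2 _] := direct_arm b1 i; exists o, s.
  have b0 := access_ge0 hb'; have w0 := walk_len_ge0 posN w.
  case: (access_arm b1 hb) => bE; rewrite bE /= in W l.
    by rewrite /B in d2; lra.
  have := dist_access posN connN hb'.
  have <- : edge_end (~~ o) e = b'.1 by apply: (trivwalk _ _ _ W); rewrite /B in d2; lra.
  by rewrite dsym; lra.
- have d3 := dist_arm2 posN connN b1 a2.
  have d4 : d (im y) (im z2') <= s - c by move: d3; rewrite /Rabs; case: Rcase_abs; lra.
  have : d (im z1') (im z2') < d (im z1') (im z2') + del by lra.
  case/(conn_of_lt posN connN) => [[x3 [i _]]|[b [b' [w [hb hb' W l]]]]].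
    by apply: ne1; have [t1 a3 _] := direct_arm a2 (direct_sym i); exists o, t1.
  have b0 := access_ge0 hb; have b'0 := access_ge0 hb'; have w0 := walk_len_ge0 posN w.
  have lw : walk_len w <= 8 * eps by rewrite /h in ff *; lra.
  have E3 := trivwalk _ _ _ W lw.
  case: (star_access s1 hb) => [E1|[o1 [e1 [eV1 E1 _ ie1]]]]; case: (access_arm a2 hb') => E2; rewrite E1 E2 /= in E3.
  (* Here [im z2'] is at position [s] beyond [c] and is joined to [im z1'] through the end of entry,
     so s is at most 3 E + (s - c + 2 E) + 2 E plus 4 [del]; hence c <= 7 E + 4 del. *)
  + by rewrite E2 /h /= in l ff dep *; lra.
  + exact: V12.
  + by apply: (@no_loop o1 e1); rewrite eV1.
  + by apply: ne1; have -> : e = e1 by apply: (@edge_uniq o o1).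
exact: (no_link (noSh _) (noSh _) d1 w2 ne1 ne2 ff8).
Qed.

Lemma seg_dist_lt o e x y t s : seg o e x y -> arm o e t (im x) -> arm o e s (im y) -> t < s ->
  d (im x) (im y) <= 10 * eps.
Proof.
move=> sg a1 b1 ts; have tb := arm_bounds a1; have sb := arm_bounds b1.
have P1 : at_pos o e t (im x) by right; right.
have P2 : at_pos o e s (im y) by right; right.
have cov q : inI o e t s q -> exists2 y, lev y & d (im y) q <= E + del.
  case=> k [hk a2]; have [|k' [t' [lk ak kl]]] := @seg_cover o e x y t s k sg a1 b1; first by left; lra.
  exists k' => //; have := dist_arm2 posN connN ak a2; rewrite /B in kl; lra.
have [||||x1 [x2 [e1 e2 dl]]] := exits_both _ ts _ P1 P2 cov sg; try lra.
- by exists t; split=> //; left; lra.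
- by exists s; split=> //; left; lra.
exact: exits_dist e1 e2 dl.
Qed.

Lemma seg_dist o e x y : seg o e x y -> d (im x) (im y) <= 10 * eps.
Proof.
move=> sg; have [_ [t a1]] := seg_head sg; have [_ [s b1]] := seg_last sg.
case: (Rtotal_order t s) => [l|[E1|l]]; first exact: seg_dist_lt sg a1 b1 l.
  by subst s; rewrite (arm_uniq a1 b1) drefl; lra.
by rewrite dsym; exact: seg_dist_lt (seg_rev sg) b1 a1 l.
Qed.

(** * Following a chain of the level set through the vertices near it *)

Definition near v := exists2 x, lev x & d (im x) (MPv v) <= E + del.
Definition nearb v : bool := is_left (excluded_middle_informative (near v)).

Lemma nearP v : reflect (near v) (nearb v).
Proof. by rewrite /nearb; case: excluded_middle_informative => ? /=; constructor. Qed.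

(** Links are restricted to vertices near the level so that, when there are no forks, different
    levels can be compared through disjoint sets of vertices. *)
Definition Kn : rel (gV N) := fun u v => [&& Kp u v, nearb u & nearb v].

Lemma near_between x y v : lev x -> lev y -> d (im x) (MPv v) + d (MPv v) (im y) <= B -> nearb v.
Proof.
move=> lx ly l; apply/nearP; have [l1|l1] := Rle_lt_dec (d (im x) (MPv v)) (E + del); first by exists x.
by exists y => //; rewrite dsym; rewrite /B in l; lra.
Qed.

(** Every vertex of a walk used by a single jump is within half of [B] of the image of [x] or of
    [y], hence near the level, and every edge of it is short. *)
Lemma walk_Kn x y u v w : lev x -> lev y -> walk u v w ->
  d (im x) (MPv u) + walk_len w + d (MPv v) (im y) <= B -> [/\ connect Kn u v, nearb u & nearb v].
Proof.
move=> lx ly; elim: w u => [|[e b] w IH] u /=.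
  move=> <- l; have nu : nearb u by apply: (near_between lx ly); lra.
  by split=> //; exact: connect0.
move=> [W1 W2] l; set u1 := (if b then gtgt e else gsrc e) in W2.
have uE : u = edge_end b e by move: W1; case: (b) => <-.
have u1E : u1 = edge_end (~~ b) e by rewrite /u1; case: (b).
have w0 := walk_len_ge0 posN w.
have due : d (MPv u) (MPv u1) <= glen e.
  have -> : glen e = walk_len ((e, b) :: nil) by rewrite /=; ring.
  by apply: dist_walk => //=; split.
have t1 := dtri (im x) (MPv u) (MPv u1).
have t2 := dtri (MPv u) (MPv u1) (im y).
have t3 := dtri (MPv u1) (MPv v) (im y); have dw := dist_walk posN connN W2.
have [|c1 n1 n2] := IH u1 W2; first by lra.
have nu : nearb u by apply: (near_between lx ly); lra.
have g8 : glen e <= 8 * eps.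
  by have := dge0 (im x) (MPv u); have := dge0 (MPv v) (im y); rewrite /B in l; lra.
split=> //; apply: connect_trans c1; apply: connect1; rewrite /Kn /= nu n1 !andbT.
by apply: KpP; [lra | rewrite uE (Sh_end b g8)].
Qed.

(** [u] is the last vertex passed: the image is at [u], or on an edge entered through [u] at [z] and
    not left since. *)
Definition located u x := im x = MPv u \/ exists o e z, [/\ edge_end o e = u, Entry o e z & seg o e z x].

Lemma arrive x y b : lev x -> lev y -> dX x y <= h -> List.In b (access (im y)) ->
  b.2 + d (MPv b.1) (im x) <= B ->
  (forall e, in_edge e (im y) -> in_edge e (im x) -> exists o, b.1 = edge_end o e /\ Entry o e y) ->
  located b.1 y.
Proof.
move=> lx ly l hb lb alt; case: (mg_pointP (im y)) => [[v yv]|[e [t a1]]].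
  by left; move: hb; rewrite yv => /access_vertex ->.
right; have [ie|nie] := classic (in_edge e (im x)).
  have [|o [E1 En]] := alt e _ ie; first by exists true, t.
  exists o, e, y; split=> //.
  by have [t' a2] := in_edge_pos o (ex_intro _ true (ex_intro _ t a1)); apply: (seg_one ly a2).
have [o [t' [bE a2]]] : exists o t', b = (edge_end o e, t') /\ arm o e t' (im y).
  by case: (access_arm a1 hb) => ->; [exists true, t | exists false, (glen e - t); split=> //; exact: (arm_flip a1)].
rewrite bE /= in lb *; exists o, e, y; split=> //; last exact: (seg_one ly a2).
by exists t', x; split=> //; [rewrite d_sym | left].
Qed.

Lemma step_vertex x y u : lev x -> lev y -> dX x y <= h -> im x = MPv u ->
  exists2 v, connect Kn u v & located v y.
Proof.
move=> lx ly l xu; case: (im_conn l) => [[x3 [i l2]]|[b [c [w [hb hc W l2]]]]].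
  by exists u; [exact: connect0 | left; move: i; rewrite xu => /direct_vertex []].
have := hb; rewrite xu => /access_vertex bE; rewrite bE /= in W l2.
have dc := dist_access posN connN hc; have dw := dist_walk posN connN W.
have [|cn _ _] := walk_Kn lx ly W; first by rewrite xu drefl dsym; lra.
exists c.1 => //; apply: (arrive lx ly l hc); first by rewrite xu dsym; lra.
by move=> e _ [o [t [H E1]]]; rewrite xu in E1.
Qed.

Lemma step_edge o e x y t : lev x -> lev y -> dX x y <= h -> arm o e t (im x) ->
  (exists2 s, arm o e s (im y) & Rabs (t - s) <= B) \/
  exists o' v, [/\ Entry o' e x, nearb (edge_end o' e), connect Kn (edge_end o' e) v & located v y].
Proof.
move=> lx ly l a1; case: (im_conn l) => [[x3 [i l2]]|[b [c [w [hb hc W l2]]]]].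
  by left; have [s a2 E1] := direct_arm a1 i; exists s; rewrite -?E1.
have dc := dist_access posN connN hc; have db := dist_access posN connN hb; have dw := dist_walk posN connN W.
have w0 := walk_len_ge0 posN w.
have [o' [t' [bE a2]]] : exists o' t', b = (edge_end o' e, t') /\ arm o' e t' (im x).
  by case: (access_arm a1 hb) => ->; [exists o, t | exists (~~ o), (glen e - t); split=> //; exact: (arm_flip a1)].
(* A connection leaving and re-entering [e] at the same end is no passage: the positions differ by
   less than its length, so it counts as a move along [e]. *)
have [loop|direct] := classic (exists2 s, arm o' e s (im y) & c = (edge_end o' e, s)).
  case: loop => s a3 cE; left; rewrite bE cE /= in l2; have := arm_bounds a2; have := arm_bounds a3 => sb tb.
  have [oo|no] := boolP (o == o').
    rewrite (eqP oo) in a1 *; exists s => //; rewrite (arm_same a1 a2).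
    by rewrite /Rabs; case: Rcase_abs; lra.
  have oE : o = ~~ o' by case: (o) (o') no => [] [].
  exists (glen e - s); first by rewrite oE; exact: arm_flip.
  have tE : t = glen e - t' by apply: (arm_same a1); rewrite oE; exact: arm_flip.
  by rewrite tE /Rabs; case: Rcase_abs; lra.
right; exists o', c.1; rewrite bE /= in W l2 db dw.
have [|cn nr _] := walk_Kn lx ly W; first by rewrite (dsym _ (im y)); lra.
have loopW : in_edge e (im y) -> exists s, [/\ arm (~~ o') e s (im y) & c = (edge_end (~~ o') e, s)].
  move/(in_edge_pos (~~ o')) => [s a3]; exists s; split=> //.
  case: (access_arm a3 hc) => //; rewrite negbK => cE.
  case: direct; exists (glen e - s) => //.
  by have := arm_flip a3; rewrite negbK.
split=> //.
- exists t', y; split=> //.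
    by have := dtri (MPv (edge_end o' e)) (MPv c.1) (im y); rewrite (dsym (MPv c.1) (im y)); lra.
  have [ie|nie] := classic (in_edge e (im y)); last by left.
  right; have [s [a3 cE]] := loopW ie; exists (glen e - s), w; rewrite cE /= in W l2; split=> //.
    by have := arm_flip a3; rewrite negbK.
  by lra.
- apply: (arrive lx ly l hc).
    by have := dtri (MPv c.1) (MPv (edge_end o' e)) (im x); rewrite (dsym (MPv c.1) (MPv _)) (dsym (MPv (edge_end o' e)) (im x)); lra.
  move=> e' ie' ie; have E1 : e' = e by case: ie => o1 [t1 a3]; case: (arm_inj a3 a2).
  subst e'; have [s [a3 cE]] := loopW ie'; exists (~~ o'); rewrite cE; split=> //.
  exists s, x; split=> //; first by rewrite d_sym.
    have := dtri (MPv (edge_end (~~ o') e)) (MPv (edge_end o' e)) (im x).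
    by rewrite cE /= in W l2 dw; rewrite (dsym (MPv (edge_end o' e)) (im x)) (dsym (MPv (edge_end (~~ o') e)) (MPv _)); lra.
  right; rewrite cE /= in W l2; have [w' W' lw'] := walk_sym W.
  exists (glen e - t'), w'; rewrite negbK; split=> //; first exact: arm_flip.
  lra.
Qed.

(** The invariant along a chain from [x0]: either its edge was never left, or the first vertex
    passed is attached to [x0] and joined by links to the last vertex passed. *)
Definition state x0 x := (exists e, seg true e x0 x) \/
  exists u v, [/\ attached x0 u, connect Kn u v, nearb v & located v x].

Lemma connect_near u v : connect Kn u v -> nearb u -> nearb v.
Proof.
by case/connectP => p; elim: p u => [|w p IH] u /= => [_ ->|/andP[/and3P[_ _ nw] pw] E1 _] //; apply: (IH w).
Qed.

Lemma state_step x0 x y : lev x -> lev y -> dX x y <= h -> state x0 x -> state x0 y.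
Proof.
move=> lx ly l [[e sg]|[u [v [at_ cn nv loc]]]].
  have [_ [t a1]] := seg_last sg.
  case: (step_edge lx ly l a1) => [[s a2 ts]|[o' [v [En nr cn loc]]]].
    by left; exists e; exact: (seg_rcons sg ly a1 a2 l ts).
  right; exists (edge_end o' e), v; split=> //; last exact: connect_near cn nr.
  apply: (attach En); apply: seg_rev.
  by case: (o'); [| have := seg_flip sg].
right; exists u; case: loc => [xv|[o [e [z [eV En sg]]]]].
  have [v' cn' loc'] := step_vertex lx ly l xv.
  exists v'; split=> //; [exact: connect_trans cn cn' | exact: connect_near cn' nv].
have [_ [t a1]] := seg_last sg.
case: (step_edge lx ly l a1) => [[s a2 ts]|[o' [v' [En' nr cn' loc]]]].
  exists v; split=> //; right; exists o, e, z; split=> //; exact: (seg_rcons sg ly a1 a2 l ts).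
exists v'; split=> //; last exact: connect_near cn' nr.
apply: connect_trans cn (connect_trans _ cn').
(* Leaving through the end of entry changes no vertex; leaving through the other end crosses the
   edge and adds the link of [traverse]. *)
have [oo|no] := boolP (o' == o); first by rewrite (eqP oo) eV; exact: connect0.
have oE : o' = ~~ o by case: (o) (o') no => [] [].
subst o'; rewrite -eV; apply: connect1; rewrite /Kn nr eV nv !andbT -eV.
exact: traverse En En' sg.
Qed.

Lemma level_chain_attached x y : chain dX lev h x y -> d (im x) (im y) <= 10 * eps \/
  exists u v, [/\ attached x u, attached y v & connect Kn u v].
Proof.
move=> ch; have [lx _] := chain_P ch.
have st0 : state x x.
  case: (mg_pointP (im x)) => [[v xv]|[e [t a1]]]; last by left; exists e; exact: (seg_one lx a1).
  right; exists v, v; split; [exact: attached_self | exact: connect0 | | by left].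
  by apply/nearP; exists x => //; rewrite xv drefl; lra.
have : state x y.
  move: st0 {lx}; move: {1 3}x => x0; elim: ch => [{}x lx|{}x z {}y lx l ch IH st] //.
  by apply: IH; have [lz _] := chain_P ch; exact: state_step st.
case=> [[e sg]|[u [v [at_ cn nv loc]]]]; first by left; exact: seg_dist sg.
right; exists u, v; split=> //; case: loc => [yv|[o [e [z [<- En sg]]]]]; first exact: attached_self.
exact: attach En sg.
Qed.

End LevelSet.

(** * Clusters of short edges *)

Section Counting.
Variable N : fgraph.
Hypotheses (posN : mg_positive N) (connN : mg_connected N).
Variable eps : R.
Hypothesis eps0 : 0 < eps.
Notation V := (gV N).
Implicit Types (u v : V) (e : gE N).

Definition vd u v := mg_dist (MPv u) (MPv v).

Lemma vd_tri u v w : vd u w <= vd u v + vd v w.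
Proof. exact: mg_dist_triangle. Qed.

Lemma vd_refl u : vd u u = 0. Proof. exact: mg_dist_refl. Qed.

Lemma INR_addn m n : INR (m + n)%N = INR m + INR n. Proof. exact: plus_INR. Qed.

(** On a path without repetition each link has an end in [P], and each vertex belongs to at most two
    links. The first vertex belongs to only one, which strengthens the induction by P u. *)
Lemma connect_dist_count (K : rel V) (P : pred V) c u v : 0 <= c ->
  (forall u v, K u v -> vd u v <= c /\ P u || P v) -> connect K u v ->
  vd u v <= 2 * c * INR #|P|.
Proof.
move=> c0 hK /connectP [p pth ->]; case/shortenP: pth => {}p pth uq _.
have le : vd u (last u p) <= c * (2 * INR (count P (u :: p)) - INR (P u)).
  elim: p u pth {uq} => [|w p IH] u /=.
    move=> _; rewrite vd_refl addn0; case: (P u) => /=; nra.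
  case/andP => /hK [l1 l2] /IH {}IH; have := vd_tri u w (last w p).
  rewrite /= in IH; rewrite !INR_addn in IH *; case: (P u) l2 IH; case: (P w) => //= _; nra.
have cl : INR (count P (u :: p)) <= INR #|P|.
  apply: le_INR; apply/leP; rewrite -size_filter -(card_uniqP (filter_uniq P uq)).
  by apply: subset_leq_card; apply/subsetP => w; rewrite mem_filter => /andP[].
apply: Rle_trans le _; have := Rmult_le_compat_l c _ _ c0 cl; have := Rmult_le_pos c _ c0 (pos_INR (P u)); lra.
Qed.

Notation short := (@short N eps).
Notation Sh := (@Sh N eps).
Notation Kp := (@Kp N eps).

Definition Hadj : rel V := fun u v => [exists e, short e &&
  (((gsrc e == u) && (gtgt e == v)) || ((gsrc e == v) && (gtgt e == u)))].

Lemma Hadj_sym : connect_sym Hadj.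
Proof. by apply: sym_connect_sym => u v; apply: eq_existsb => e; rewrite orbC. Qed.

Lemma connect_Kp_sym : connect_sym Kp.
Proof. by apply: sym_connect_sym => u v; rewrite /Kp (mg_dist_sym posN connN (MPv u)) orbC. Qed.

Lemma short_le e : short e -> glen e <= 8 * eps.
Proof. by rewrite /short; case: Rle_dec. Qed.

Lemma Hadj_dist u v : Hadj u v -> exists2 e, short e & vd u v <= 8 * eps /\
  ((gsrc e = u /\ gtgt e = v) \/ (gsrc e = v /\ gtgt e = u)).
Proof.
case/existsP => e /andP[se h]; exists e => //; have := short_le se => l.
have W b : walk (edge_end b e) (edge_end (~~ b) e) ((e, b) :: nil) by case: b.
case/orP: h => /andP[/eqP h1 /eqP h2]; split; auto.
  by have := dist_walk posN connN (W true); rewrite /vd /= h1 h2; lra.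
by have := dist_walk posN connN (W false); rewrite /vd /= h1 h2; lra.
Qed.

Lemma Hadj_Kp u v : Hadj u v -> Kp u v.
Proof.
move=> H; have [e se [l h]] := Hadj_dist H; apply: KpP; first by rewrite /vd in l; lra.
apply/orP; left; apply/existsP; exists e; rewrite se /=.
by case: h => -[-> ->]; rewrite eqxx ?orbT.
Qed.

(** Components of the subgraph formed by the short edges, by representatives; [ncl] counts the short
    edges in a component. *)
Definition rt := fingraph.root Hadj.
Definition ncl (z : V) := #|[pred e | short e && (rt (gsrc e) == z)]|.

Lemma rt_eq u v : (rt u == rt v) = connect Hadj u v.
Proof. exact: root_connect Hadj_sym _ _. Qed.

(** The first edge of a simple path has an end that does not recur, so it is not among the edges
    with both ends in the rest. *)
Lemma Hpath_dist u p : path Hadj u p -> uniq (u :: p) ->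
  vd u (last u p) <= 8 * eps * INR #|[pred e | [&& short e, gsrc e \in u :: p & gtgt e \in u :: p]]|.
Proof.
elim: p u => [|w p IH] u.
  by move=> _ _ /=; rewrite vd_refl; apply: Rmult_le_pos; [lra | exact: pos_INR].
move=> /= /andP[uw pth] /andP[nu uq]; have [e se [l h]] := Hadj_dist uw.
have le := IH w pth uq; have := vd_tri u w (last w p).
set A := #|_| in le; set A' := #|_|.
suff /leP /le_INR : (A < A')%N by rewrite S_INR; nra.
apply: proper_card; apply/properP; split.
  by apply/subsetP => k; rewrite !inE => /and3P[-> /= h1 h2]; rewrite h1 h2 !orbT.
exists e; rewrite !inE se /=; first by case: h => -[-> ->]; rewrite !eqxx ?orbT.
apply/negP => /andP[h1 h2]; move: nu; rewrite inE => /negP; apply.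
by case: h => -[E1 E2]; move: h1 h2; rewrite E1 E2.
Qed.

Lemma class_dist u v : rt u = rt v -> vd u v <= 8 * eps * INR (ncl (rt u)).
Proof.
move/eqP; rewrite rt_eq => /connectP [p pth ->]; case/shortenP: pth => {}p pth uq _.
apply: Rle_trans (Hpath_dist pth uq) _; apply: Rmult_le_compat_l; first by lra.
apply: le_INR; apply/leP; apply: subset_leq_card; apply/subsetP => e; rewrite !inE => /and3P[-> h _] /=.
by rewrite rt_eq Hadj_sym; apply: (path_connect pth); rewrite inE.
Qed.

Lemma Sh_ncl u : Sh u -> 1 <= INR (ncl (rt u)).
Proof.
case/existsP => e /andP[se h]; apply: (le_INR 1); apply/leP; apply/card_gt0P; exists e.
rewrite inE se /= rt_eq; case/orP: h => /eqP <-; first exact: connect0.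
by apply: connect1; apply/existsP; exists e; rewrite se !eqxx.
Qed.

Lemma Kp_dist u v : Kp u v -> vd u v <= 10 * eps /\ Sh u || Sh v.
Proof. by rewrite /Kp => /andP[]; case: Rle_dec. Qed.

(** The relation that [Kp] induces on the components of short edges. *)
Definition qadj : rel V := fun y z => [exists u, [exists v, [&& rt u == y, rt v == z & Kp u v]]].

(** Crossing a component costs 8 eps per short edge. A link costs 10 eps and has an end on a short
    edge, so it is paid by the components it joins; each belongs to at most two links, whence 8 + 2
    * 10 = 28. The first one belongs to a single link, whence the subtracted term. *)
Lemma qpath_dist p y u v : path qadj y p -> rt u = y -> rt v = last y p ->
  vd u v <= 28 * eps * INR (\sum_(z <- y :: p) ncl z)%N - 10 * eps * INR (ncl y).
Proof.
elim: p y u => [|z p IH] y u /=.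
  move=> _ uy vy; rewrite big_seq1; have := class_dist (etrans uy (esym vy)); rewrite uy.
  have := pos_INR (ncl y); nra.
case/andP => /existsP [u1 /existsP [v1 /and3P[/eqP h1 /eqP h2 /Kp_dist [l s]]]] pth uy vz.
rewrite big_cons INR_addn; have := IH z v1 pth h2 vz; have := class_dist (etrans uy (esym h1)).
rewrite uy => cl; have := vd_tri u u1 v; have := vd_tri u1 v1 v.
have : 1 <= INR (ncl y) + INR (ncl z).
  by case/orP: s => /Sh_ncl; rewrite ?h1 ?h2; [have := pos_INR (ncl z) | have := pos_INR (ncl y)]; lra.
nra.
Qed.

Definition kroot := fingraph.root Kp.
Definition kcnt (Q : {set V}) := #|[set e | short e && (kroot (gsrc e) \in Q)]|.

Lemma kroot_eq u v : (kroot u == kroot v) = connect Kp u v.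
Proof. exact: root_connect connect_Kp_sym _ _. Qed.

Lemma sum_ncl (s : seq V) : uniq s -> (\sum_(z <- s) ncl z)%N = #|[pred e | short e && (rt (gsrc e) \in s)]|.
Proof.
elim: s => [|z s IH] /=; first by move=> _; rewrite big_nil eq_card0 // => e; rewrite !inE andbF.
case/andP => nz /IH {}IH; rewrite big_cons IH /ncl -cardUI.
rewrite [X in (_ + X)%N]eq_card0 ?addn0; last first.
  by move=> e; rewrite !inE; apply/negbTE/negP => /andP[/andP[_ /eqP ->] /andP[_]]; apply/negP.
by apply: eq_card => e; rewrite !inE andb_orr.
Qed.

Lemma Kp_class_dist u v : connect Kp u v -> vd u v <= 28 * eps * INR (kcnt [set kroot u]).
Proof.
move=> cn; have rtK w : connect Kp w (rt w).
  have : connect Hadj w (rt w) by rewrite -rt_eq /rt root_root //; exact: Hadj_sym.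
  by apply: connect_sub => a b /Hadj_Kp; exact: connect1.
have qK y z : qadj y z -> connect Kp y z.
  case/existsP => a /existsP [b /and3P[/eqP <- /eqP <- k]].
  by rewrite (connect_trans _ (connect_trans (connect1 k) (rtK b))) // connect_Kp_sym.
have : connect qadj (rt u) (rt v).
  case/connectP: cn => p; elim: p u => [|w p IH] u /=; first by move=> _ ->; exact: connect0.
  case/andP => k pth E; apply: connect_trans (IH w pth E); apply: connect1.
  by apply/existsP; exists u; apply/existsP; exists w; rewrite !eqxx.
case/connectP => p pth E; case/shortenP: pth E => {}p pth uq _ E.
have le := qpath_dist pth erefl E; rewrite sum_ncl // in le.
have : INR #|[pred e | short e && (rt (gsrc e) \in rt u :: p)]| <= INR (kcnt [set kroot u]).
  apply: le_INR; apply/leP; apply: subset_leq_card; apply/subsetP => e; rewrite !inE => /andP[-> h] /=.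
  rewrite kroot_eq; apply: connect_trans (rtK _) _.
  have : connect Kp (rt u) (rt (gsrc e)).
    have : connect qadj (rt u) (rt (gsrc e)) by apply: (path_connect pth); rewrite inE.
    by apply: connect_sub.
  by move=> h2; rewrite connect_Kp_sym; exact: connect_trans (rtK u) h2.
have := pos_INR (ncl (rt u)); nra.
Qed.

Lemma kcnt_split (Q : {set V}) z : z \in Q -> (kcnt [set z] + kcnt (Q :\ z) = kcnt Q)%N.
Proof.
move=> zQ; rewrite /kcnt -cardsUI [X in (_ + X)%N](_ : _ = 0%N) ?addn0.
  apply: eq_card => e; rewrite !inE; case: (short e) => //=.
  by case: eqP => [->|].
by apply: eq_card0 => e; rewrite !inE; case: eqP; rewrite ?andbF // => _; rewrite ?andbF.
Qed.

Lemma kcnt_le (Q : {set V}) : (kcnt Q <= n_short_edges N (8 * eps))%N.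
Proof. by apply: subset_leq_card; apply/subsetP => e; rewrite !inE => /andP[]. Qed.

Lemma card_Sh : (#|Sh| <= 2 * n_short_edges N (8 * eps))%N.
Proof.
have : (#|Sh| <= #|[set gsrc e | e in short] :|: [set gtgt e | e in short]|)%N.
  apply: subset_leq_card; apply/subsetP => v /existsP [e /andP[se /orP[/eqP <-|/eqP <-]]]; rewrite inE.
    by rewrite imset_f.
  by rewrite imset_f ?orbT.
move/leq_trans; apply; apply: leq_trans (leq_card_setU _ _) _.
by rewrite mul2n -addnn; apply: leq_add; apply: leq_imset_card.
Qed.

End Counting.

(** * Estimating the jumps *)

Lemma last_failure (T : Type) (P : T -> Prop) l : ~ List.Forall P l ->
  exists l1 c l2, [/\ l = l1 ++ c :: l2, ~ P c & List.Forall P l2].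
Proof.
elim: l => [|c l IH] nf; first by case: nf.
have [fl|/IH [l1 [k [l2 [E nk fl]]]]] := classic (List.Forall P l).
  exists nil, c, l; split=> // Pc; apply: nf; by constructor.
by exists (c :: l1), k, l2; rewrite E.
Qed.

Section Jumps.
Variables (X : Type) (dX : X -> X -> R).
Hypothesis mX : is_metric dX.
Variable N : fgraph.
Hypotheses (posN : mg_positive N) (connN : mg_connected N).
Variables (im : X -> mg_point N) (eps : R).
Hypothesis eps0 : 0 < eps.
Hypothesis im_dist : forall x y, Rabs (dX x y - mg_dist (im x) (im y)) <= 2 * eps.

Notation d := (@mg_dist N).
Let dtri := mg_dist_triangle posN connN.

Let d_le x y : d (im x) (im y) <= dX x y + 2 * eps.
Proof. by have := im_dist x y; rewrite /Rabs; case: Rcase_abs; lra. Qed.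

Definition linked (Q : {set gV N}) (pq : X * X) := d (im pq.1) (im pq.2) <= 10 * eps \/
  exists u v, [/\ d (im pq.1) (MPv u) <= 10 * eps, d (im pq.2) (MPv v) <= 10 * eps,
    connect (Kp eps) u v & kroot eps u \in Q].

Lemma jump_len_drop x l1 p q l2 y : jump_len dX q l2 y <= jump_len dX x (l1 ++ (p, q) :: l2) y.
Proof.
elim: l1 x => [|[p1 q1] l1 IH] x /=; first by have := d_ge0 mX x p; lra.
by have := IH q1; have := d_ge0 mX x p1; lra.
Qed.

(* If the class of the first jump is used again, skip to the last jump using it; either way this class
   is removed from [Q] for the remaining jumps. *)
Lemma jumps_dist l (Q : {set gV N}) x y : List.Forall (linked Q) l ->
  d (im x) (im y) <= jump_len dX x l y + 22 * eps * INR (size l) + 2 * eps + 28 * eps * INR (kcnt eps Q).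
Proof.
have [n] := ubnP (size l); elim: n l Q x => // n IH l Q x /ltnSE ln.
have cQ (Q' : {set gV N}) : 0 <= 28 * eps * INR (kcnt eps Q') by apply: Rmult_le_pos; [lra | exact: pos_INR].
case: l ln => [|[p q] l] ln; first by move=> _ /=; have := d_le x y; have := cQ Q; lra.
move=> h; inversion h as [|? ? h1 h2]; subst; rewrite [size _]/= S_INR.
(* The leg before a jump costs 2 eps in the image and the two attachments cost 10 eps each, whence
   22 eps per jump; the final 2 eps are for the last leg. *)
have xp := d_le x p.
have t1 := dtri (im x) (im p) (im y).
case: h1 => [|[u [v [pu qv cn uQ]]]] /=.
  move=> pq; have := IH l Q q ln h2; have := dtri (im p) (im q) (im y); lra.
set S := kroot eps u in uQ.
have near q' v' : d (im q') (MPv v') <= 10 * eps -> kroot eps v' = S ->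
    d (im p) (im q') <= 20 * eps + 28 * eps * INR (kcnt eps [set S]).
  move=> l1 E; have cn' : connect (Kp eps) u v' by rewrite -(kroot_eq posN connN) E.
  have := Kp_class_dist posN connN eps0 cn'; rewrite /vd -/S => l2.
  have := dtri (im p) (MPv u) (im q'); have := dtri (MPv u) (MPv v') (im q').
  rewrite (mg_dist_sym posN connN (MPv v')) /= in pu *; lra.
have split := kcnt_split eps uQ; have := f_equal INR split; rewrite plus_INR => splitR.
have fin q' l' : (size l' <= size l)%N -> jump_len dX q' l' y <= jump_len dX q l y ->
    d (im p) (im q') <= 20 * eps + 28 * eps * INR (kcnt eps [set S]) -> List.Forall (linked (Q :\ S)) l' ->
    d (im x) (im y) <= dX x p + jump_len dX q l y + 22 * eps * (INR (size l) + 1) + 2 * eps + 28 * eps * INR (kcnt eps Q).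
  move=> sl jl dq fl; have := IH l' (Q :\ S) q' (leq_ltn_trans sl ln) fl.
  have := dtri (im p) (im q') (im y); have /leP /le_INR := sl; nra.
have [fl|/last_failure [l1 [[p2 q2] [l2 [E n2 fl]]]]] := classic (List.Forall (linked (Q :\ S)) l).
  apply: (fin q l) => //; first by lra.
  by apply: (near q v) => //; apply/eqP; rewrite (kroot_eq posN connN) connect_Kp_sym.
have : linked Q (p2, q2) by move: h2; rewrite E => /List.Forall_app [_ h3]; inversion h3.
case=> [l3|[u2 [v2 [a1 a2 a3 a4]]]]; first by case: n2; left.
have uS : kroot eps u2 = S.
  by apply/eqP; apply: contraT => ne; case: n2; right; exists u2, v2; split=> //; rewrite !inE ne.
apply: (fin q2 l2) => //.
- by rewrite E size_cat /=; lia.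
- by rewrite E; exact: jump_len_drop.
apply: (near q2 v2) => //; rewrite -uS; apply/eqP; rewrite (kroot_eq posN connN) connect_Kp_sym //.
Qed.

End Jumps.

Lemma jumps_uniform (X : Type) (dX : X -> X -> R) D l x y : is_metric dX ->
  List.Forall (fun pq => dX pq.1 pq.2 <= D) l -> dX x y <= jump_len dX x l y + D * INR (size l).
Proof.
move=> mX; elim: l x => [|[p q] l IH] x h; first by rewrite /=; lra.
inversion h as [|? ? h1 h2]; subst; rewrite [size _]/= S_INR /= in h1 *.
have := IH q h2; have := d_tri mX x p y; have := d_tri mX p q y; lra.
Qed.

(** * Diameter of the fibres *)

Section Fibres.
Variables (X : Type) (dX : X -> X -> R) (r : X) (T : Type) (Pi : X -> T).
Hypotheses (mX : is_metric dX) (cX : compact_space dX) (pX : path_metric dX).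
Variable N : fgraph.
Hypothesis fmg : finite_metric_graph N.
Variables (im : X -> mg_point N) (E del eps : R).
Hypotheses (E0 : 0 <= E) (del0 : 0 < del) (Eeps : E + 50 * del <= eps).
Hypothesis im_dist : forall x y, Rabs (dX x y - mg_dist (im x) (im y)) <= 2 * E.
Hypothesis fibre_level : forall p q, Pi p = Pi q -> dX r p = dX r q.
Hypothesis fibre_chain : forall p q h, 0 < h -> Pi p = Pi q -> chain dX (lev dX r (dX r p)) h p q.

Let posN : mg_positive N. Proof. by case: fmg. Qed.
Let connN : mg_connected N. Proof. by case: fmg => _ []. Qed.
Notation d := (@mg_dist N).
Notation nshort := (n_short_edges N (8 * eps)).

Let h0 : 0 < del / 2. Proof. lra. Qed.

Let im_ge' p q c : d (im p) (im q) <= c -> dX p q <= c + 2 * E.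
Proof. by move=> l; have := im_dist p q; rewrite /Rabs; case: Rcase_abs; lra. Qed.

Let shallow p q c : Pi p = Pi q -> dX r p <= c -> dX p q <= 2 * c.
Proof. by move=> /fibre_level l1 l2; have := d_tri mX p r q; rewrite (d_sym mX p r); lra. Qed.

Lemma fibre_attached p q : Pi p = Pi q -> 3 * E + 3 * del < dX r p ->
  d (im p) (im q) <= 10 * eps \/ exists u v, [/\ attached im eps p u, attached im eps q v &
    connect (Kn dX r im E del eps (dX r p)) u v].
Proof.
by move=> pq deep; apply: (level_chain_attached mX cX pX fmg E0 del0 Eeps im_dist deep); apply: fibre_chain.
Qed.

Lemma fibre_no_short p q : nshort = 0%N -> Pi p = Pi q -> dX p q <= 16 * eps.
Proof.
move=> n0 pq; have [l|deep] := Rle_lt_dec (dX r p) (3 * E + 3 * del); first by have := shallow pq l; lra.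
have noSh (v : gV N) : ~~ Sh eps v.
  apply/negP => sv; have : (0 < #|@Sh N eps|)%N by apply/card_gt0P; exists v.
  by have := card_Sh N eps; rewrite n0 leqn0 => /eqP ->.
case: (fibre_attached pq deep) => [/im_ge'|[u [v [[_ /(_ noSh) pu] [_ /(_ noSh) qv] cn]]]]; first lra.
(* A link needs an end on a short edge, so without short edges there are no links. *)
have uv : u = v.
  case/connectP: cn => -[|w s] //= /andP[/and3P[+ _ _] _] _.
  by rewrite /Kp (negbTE (noSh u)) (negbTE (noSh w)) andbF.
subst v; have := mg_dist_triangle posN connN (im p) (MPv u) (im q).
rewrite (mg_dist_sym posN connN (MPv u)) => l.
have /im_ge' : d (im p) (im q) <= 14 * eps by lra.
lra.
Qed.

Lemma fibre_linked p q : Pi p = Pi q -> linked im eps setT (p, q).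
Proof.
move=> pq; have [l|deep] := Rle_lt_dec (dX r p) (3 * E + 3 * del).
  by left; have := shallow pq l; have := im_dist p q; rewrite /= /Rabs; case: Rcase_abs; lra.
case: (fibre_attached pq deep) => [l|[u [v [[pu _] [qv _] cn]]]]; first by left.
right; exists u, v; split=> //.
by apply: connect_sub cn => a b /and3P[k _ _]; exact: connect1.
Qed.

Definition level_count a := #|[pred v | Sh eps v && nearb dX r im E del a v]|.

(** The two attachments and the distortion give 10 + 10 + 2; each endpoint of a short edge near the
    level is in at most two links, whence 2 * 10. *)
Lemma fibre_near p q : Pi p = Pi q -> 3 * E + 3 * del < dX r p ->
  dX p q <= (22 + 20 * INR (level_count (dX r p))) * eps.
Proof.
move=> pq deep; have eps0 : 0 < eps by lra.
have ge0 := pos_INR (level_count (dX r p)).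
case: (fibre_attached pq deep) => [/im_ge'|[u [v [[pu _] [qv _] cn]]]]; first nra.
have step b c : Kn dX r im E del eps (dX r p) b c -> vd b c <= 10 * eps /\
    [pred v | Sh eps v && nearb dX r im E del (dX r p) v] b || [pred v | Sh eps v && nearb dX r im E del (dX r p) v] c.
  by move=> /and3P[/Kp_dist [l s] nb nc]; split=> //=; rewrite nb nc !andbT.
have eps10 : 0 <= 10 * eps by lra.
have l : vd u v <= 2 * (10 * eps) * INR (level_count (dX r p)) := connect_dist_count posN connN eps10 step cn.
have t1 := mg_dist_triangle posN connN (im p) (MPv u) (im q).
have t2 := mg_dist_triangle posN connN (MPv u) (MPv v) (im q).
rewrite (mg_dist_sym posN connN (MPv v)) in t2; rewrite /vd in l.
have /im_ge' : d (im p) (im q) <= 20 * eps + 2 * (10 * eps) * INR (level_count (dX r p)) by lra.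
lra.
Qed.

(** A vertex near two levels would give points of these levels at distance at most 4 E + 2 del, less
    than 4 eps. *)
Lemma level_count_disjoint a b c : a - b >= 4 * eps -> b - c >= 4 * eps ->
  (level_count a + level_count b + level_count c <= 2 * nshort)%N.
Proof.
move=> ab bc; apply: leq_trans (card_Sh N eps); rewrite /level_count -!sum1_card.
rewrite (big_mkcond (fun v => v \in _)) [X in (_ + X + _)%N]big_mkcond [X in (_ + X)%N]big_mkcond.
rewrite [X in (_ <= X)%N]big_mkcond -!big_split; apply: leq_sum => v _ /=; rewrite !inE -topredE /=.
have far a' b' : a' - b' >= 4 * eps -> ~ (near dX r im E del a' v /\ near dX r im E del b' v).
  move=> ab' [[x lx dx] [y ly dy]]; have := mg_dist_triangle posN connN (im x) (MPv v) (im y).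
  rewrite (mg_dist_sym posN connN (MPv v)) => t.
  have /im_ge' : d (im x) (im y) <= 2 * E + 2 * del by lra.
  have := d_tri mX r y x; rewrite (d_sym mX y x) /lev in lx ly *; lra.
case: (Sh eps v) => //=.
case: (nearP dX r im E del a v) => na; case: (nearP dX r im E del b v) => nb;
  case: (nearP dX r im E del c v) => nc //=.
- by case: (far a b ab).
- by case: (far a b ab).
- by case: (far a c) => //; lra.
- by case: (far b c bc).
Qed.

(** The constant 38 is the 22 of [fibre_near] plus 16 for the two descents of at most 8 eps; fibres
    too close to the root for three levels have diameter at most 22 eps. *)
Lemma fibre_three_levels p q :
  (forall p q s, Pi p = Pi q -> 0 <= s <= dX r p ->
    exists p' q', [/\ dX p p' = s, dX q q' = s, dX r p' = dX r p - s & Pi p' = Pi q']) ->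
  Pi p = Pi q -> exists2 k : nat, (3 * k <= 2 * nshort)%N & dX p q <= (38 + 20 * INR k) * eps.
Proof.
move=> down pq; have eps0 : 0 < eps by lra.
have [l|deep] := Rle_lt_dec (dX r p) (8 * eps + 3 * E + 3 * del).
  by exists 0%N => //; have := shallow pq l; rewrite /=; lra.
have level s : 0 <= s <= 8 * eps -> dX p q <= 2 * s + (22 + 20 * INR (level_count (dX r p - s))) * eps.
  move=> [s0 s1]; have [|p' [q' [d1 d2 d3 d4]]] := down p q s pq; first by lra.
  have := fibre_near d4; rewrite d3 => /(_ ltac:(lra)).
  have := d_tri mX p p' q; have := d_tri mX p' q' q; rewrite (d_sym mX q' q); lra.
have [l0 l4 l8] := And3 (level 0 ltac:(lra)) (level (4 * eps) ltac:(lra)) (level (8 * eps) ltac:(lra)).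
have := @level_count_disjoint (dX r p - 0) (dX r p - 4 * eps) (dX r p - 8 * eps) ltac:(lra) ltac:(lra).
move: l0 l4 l8; set k0 := level_count _; set k4 := level_count _; set k8 := level_count _ => l0 l4 l8 s.
have [c|c] := leqP (3 * k0) (2 * nshort); first by exists k0 => //; lra.
have [c'|c'] := leqP (3 * k4) (2 * nshort); first by exists k4 => //; lra.
by exists k8; [lia | lra].
Qed.

End Fibres.

(** * Comparing both metrics *)

Section Assembly.
Variables (X : Type) (dX : X -> X -> R) (r : X) (M : fgraph) (Pi : X -> mg_point M) (f : mg_point M -> R)
  (vr : gV M).
Hypotheses (mX : is_metric dX) (cX : compact_space dX) (pX : path_metric dX).
Hypotheses (posM : mg_positive M) (connM : mg_connected M).
Hypothesis fPi : forall x, f (Pi x) = dX r x.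
Hypothesis Pi_surj : forall p, exists x, Pi x = p.
Hypothesis f_edge : forall e t t' p p', on_edge e t p -> on_edge e t' p' -> Rabs (t - t') = Rabs (f p - f p').
Hypothesis Pi_cont : forall U, open_in (@mg_dist M) U -> open_in dX (fun x => U (Pi x)).
Hypothesis Pi_root : Pi r = MPv vr.
Hypothesis fibre_curve : forall p q, Pi p = Pi q ->
  exists g, curve dX g p q /\ forall t, unit_interval t -> dX r (g t) = dX r p.
Variable N : fgraph.
Hypothesis fmg : finite_metric_graph N.
Variables (im : X -> mg_point N) (eta eps : R).
Hypotheses (eta_lt : eta < 2 * eps) (im_dist : forall x y, Rabs (dX x y - mg_dist (im x) (im y)) <= eta).
Notation n := (n_short_edges N (8 * eps)).

(** [T] bounds a distortion, of which [dGH] takes half; hence the factor 2. *)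
Lemma distance_bound : exists T, [/\ 0 <= T, T < 2 * ((IZR (betti1 M) + 1) * (17 + 8 * INR n) * eps)
  & forall x y, dX x y <= mg_dist (Pi x) (Pi y) + T].
Proof.
have eta0 : 0 <= eta by have := im_dist r r; have := Rabs_pos (dX r r - mg_dist (im r) (im r)); lra.
have eps0 : 0 < eps by lra.
have E0 : 0 <= eta / 2 by lra.
have del0 : 0 < (eps - eta / 2) / 50 by lra.
have Eeps : eta / 2 + 50 * ((eps - eta / 2) / 50) <= eps by lra.
have imE x y : Rabs (dX x y - mg_dist (im x) (im y)) <= 2 * (eta / 2) by have := im_dist x y; lra.
have imeps x y : Rabs (dX x y - mg_dist (im x) (im y)) <= 2 * eps by have := im_dist x y; lra.
have level p q : Pi p = Pi q -> dX r p = dX r q by rewrite -!fPi => ->.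
have fchain p q h : 0 < h -> Pi p = Pi q -> chain dX (lev dX r (dX r p)) h p q.
  by move=> h0 /fibre_curve [g [[cg [<- <-]] lg]]; apply: (curve_chain mX).
set F := #|isfork f|.
have Fb : INR F <= IZR (betti1 M).
  have := forks_le_betti mX cX pX posM connM fPi Pi_surj f_edge Pi_cont Pi_root.
  by rewrite -/F INR_IZR_INZ => /IZR_le.
have F0 := pos_INR F; have n0 := pos_INR n.
have goal T : T < 2 * ((INR F + 1) * (17 + 8 * INR n) * eps) ->
    T < 2 * ((IZR (betti1 M) + 1) * (17 + 8 * INR n) * eps).
  move=> l; apply: Rlt_le_trans l _; apply: Rmult_le_compat_l; first lra.
  by apply: Rmult_le_compat_r; [lra | apply: Rmult_le_compat_r; lra].
have all_jumps T : (forall x y l, fibre_pairs Pi l -> size l = (2 * F + 1)%N -> dX x y <= jump_len dX x l y + T) ->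
    forall x y, dX x y <= mg_dist (Pi x) (Pi y) + T.
  move=> h x y; apply: le_epsilon => k k0.
  have [l [sl fl jl]] := reach_dist mX cX pX posM connM fPi Pi_surj f_edge Pi_cont x y k0.
  by have := h x y l fl sl; lra.
have sizeR (l : list (X * X)) : size l = (2 * F + 1)%N -> INR (size l) = 2 * INR F + 1.
  by move=> ->; rewrite plus_INR mult_INR /=; lra.
have [nz|nz] := eqVneq n 0%N.
  (* Each of the 2 F + 1 jumps costs at most 16 eps, and 16 (2 F + 1) < 34 (F + 1). *)
  exists (16 * eps * (2 * INR F + 1)); split; first by nra.
    by apply: goal; rewrite nz /=; nra.
  apply: all_jumps => x y l fl /sizeR <-; apply: jumps_uniform mX _.
  apply: List.Forall_impl fl => -[p q] /= pq.
  exact: (fibre_no_short mX cX pX fmg E0 del0 Eeps imE level fchain nz pq).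
have n1 : 1 <= INR n by apply: (le_INR 1); lia.
have [Fz|Fz] := eqVneq F 0%N.
  have noF v : ~~ isfork f v.
    by apply/negP => iv; have : (0 < F)%N by [apply/card_gt0P; exists v]; rewrite Fz.
  exists ((30 + 16 * INR n) * eps); split; first by nra.
    by apply: goal; rewrite Fz /=; nra.
  apply: all_jumps => x y l fl sl.
  have -> : (30 + 16 * INR n) * eps = (30 + 16 * INR n) * eps * INR (size l) by rewrite sl Fz /=; ring.
  apply: jumps_uniform mX _; apply: List.Forall_impl fl => -[p q] /= pq.
  have down p1 q1 s := @common_descent X dX r M Pi f vr mX cX pX posM connM fPi Pi_surj f_edge Pi_cont Pi_root p1 q1 s noF.
  have [k k1 k2] := fibre_three_levels mX cX pX fmg E0 del0 Eeps imE level fchain down pq.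
  apply: Rle_trans k2 _; apply: Rmult_le_compat_r; first lra.
  (* Integrality of [k] matters: with 3 k <= 2 n over the reals the inequality would fail for n = 1
     and n = 2. *)
  have : INR (8 + 20 * k) <= INR (16 * n) by apply: le_INR; lia.
  by rewrite plus_INR !mult_INR /=; lra.
have F1 : 1 <= INR F by apply: (le_INR 1); lia.
(* The 4 consists of the last leg and of the return from the image to X. The allowed value exceeds
   this one by 16 (F - 1) (n - 1) + 6 F + 4 n - 8 times eps, which is positive for F, n >= 1. *)
exists ((22 * (2 * INR F + 1) + 4 + 28 * INR n) * eps); split; first by nra.
  apply: goal; rewrite -Rmult_assoc; apply: Rmult_lt_compat_r => //.
  have : 0 <= (INR F - 1) * (INR n - 1) by apply: Rmult_le_pos; lra.
  lra.
apply: all_jumps => x y l fl sl.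
have posN : mg_positive N by case: fmg.
have connN : mg_connected N by case: fmg => _ [].
have lk : List.Forall (linked im eps setT) l.
  apply: List.Forall_impl fl => -[p q] /= pq.
  exact: (fibre_linked mX cX pX fmg E0 del0 Eeps imE level fchain pq).
have := jumps_dist mX posN connN eps0 imeps x y lk; rewrite sizeR //.
have kn : INR (kcnt eps [set: gV N]) <= INR n by apply: le_INR; apply/leP; exact: kcnt_le.
have : 28 * eps * INR (kcnt eps [set: gV N]) <= 28 * eps * INR n by apply: Rmult_le_compat_l; lra.
have := imeps x y; rewrite /Rabs; case: Rcase_abs => ?; lra.
Qed.

End Assembly.

Theorem theorem3
  (X : Type) (dX : X -> X -> R) (r : X)
  (G : Type) (pi : X -> G) (dstar : G -> R)
  (M : fgraph) (phi : G -> mg_point M)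
  (G' : fgraph) (eps : R) :
  is_metric dX -> compact_space dX -> connected_space dX -> path_metric dX ->
  reeb_quotient dX r pi ->
  (forall x, dX r x = dstar (pi x)) ->
  reeb_metric_structure dX r pi dstar phi ->
  0 < eps ->
  finite_metric_graph G' ->
  Rbar_lt (dGH dX (@mg_dist G')) (Finite eps) ->
  Rbar_lt (dGH dX (reeb_dist phi))
    (Finite ((IZR (betti1 M) + 1) * (17 + 8 * INR (n_short_edges G' (8 * eps))) * eps))
  /\
  ((forall e : gE G', 8 * eps < glen e) ->
   Rbar_lt (dGH dX (reeb_dist phi)) (Finite (17 * (IZR (betti1 M) + 1) * eps))).
Proof.
move=> mX cX _ pX [pi_surj pi_eq] ds [posM [connM [phi_inj [phi_surj [homeo [_ [vert edge]]]]]]] eps0 fmg hGH.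
suff main : Rbar_lt (dGH dX (reeb_dist phi))
    (Finite ((IZR (betti1 M) + 1) * (17 + 8 * INR (n_short_edges G' (8 * eps))) * eps)).
  split=> // long; move: main; suff -> : n_short_edges G' (8 * eps) = 0%N.
    by rewrite /= (_ : _ * _ * eps = 17 * (IZR (betti1 M) + 1) * eps) //; ring.
  by apply: eq_card0 => e; rewrite !inE; case: Rle_dec => //= l; have := long e; lra.
have [eta [C [eta_lt [C1 C2] dist]]] := dGH_lt_inv hGH.
pose im x := proj1_sig (constructive_indefinite_description _ (C1 x)).
have imC x : C x (im x) := proj2_sig (constructive_indefinite_description _ (C1 x)).
pose inv p := proj1_sig (constructive_indefinite_description _ (phi_surj p)).
have invK p : phi (inv p) = p := proj2_sig (constructive_indefinite_description _ (phi_surj p)).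
pose f p := dstar (inv p).
have fphi g : f (phi g) = dstar g by rewrite /f; congr dstar; apply: phi_inj; rewrite invK.
have [vr vrE] : exists v, phi (pi r) = MPv v by apply: vert; right.
have [T [T0 Tlt bound]] : exists T, [/\ 0 <= T,
    T < 2 * ((IZR (betti1 M) + 1) * (17 + 8 * INR (n_short_edges G' (8 * eps))) * eps)
    & forall x y, dX x y <= mg_dist (phi (pi x)) (phi (pi y)) + T].
  apply: (@distance_bound X dX r M (fun x => phi (pi x)) f vr _ _ _ _ _ _ _ _ _ _ _ G' fmg im eta eps) => //.
  - by move=> x; rewrite fphi ds.
  - by move=> p; have [x xE] := pi_surj (inv p); exists x; rewrite xE invK.
  - by move=> e t t' p p' h h'; apply: (edge e); rewrite invK.
  - move=> U oU; apply: (proj2 (homeo (fun g => U (phi g)))) => p [g [Ug gp]]; have Up : U p by rewrite -gp.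
    have [k [k0 hk]] := oU p Up; exists k; split=> // q /hk Uq.
    by exists (inv q); rewrite invK.
  - move=> p q /phi_inj /pi_eq [_ [g [cg lg]]]; by exists g.
  - by move=> x y; apply: dist.
apply: (dGH_lt (C := fun x g => pi x = g) T0 Tlt).
  by split=> [x|g]; [exists (pi x) | have [x xE] := pi_surj g; exists x].
move=> x g x' g' <- <-; rewrite /reeb_dist.
have fPi y : f (phi (pi y)) = dX r y by rewrite fphi ds.
have low := @Pi_lip X dX r M (fun x => phi (pi x)) f mX pX posM connM fPi _ _ x x'.
have := bound x x'; rewrite /Rabs; case: Rcase_abs => ? ?; last lra.
suff : mg_dist (phi (pi x)) (phi (pi x')) <= dX x x' by lra.
apply: low.
- by move=> e t t' p p' h h'; apply: (edge e); rewrite invK.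
- move=> U oU; apply: (proj2 (homeo (fun g => U (phi g)))) => p [k [Ug gp]]; have Up : U p by rewrite -gp.
  have [c [k0 hk]] := oU p Up; exists c; split=> // q /hk Uq.
  by exists (inv q); rewrite invK.
Qed.
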